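(* The family $\{S_{CD}(\alpha,\beta,\gamma,\delta):(\alpha:\beta:\gamma:\delta)\in T_0\}$ can be regarded as the subfamily of $\{S([t]):[t]\in T\}$ corresponding to $t_{18}=0$; that is, there is an identification of $T_0$ with $\{[t]\in T:t_{18}=0\}$ under which corresponding members of the two families are isomorphic.
   Context: For $(\alpha:\beta:\gamma:\delta)\in\mathbb P(4,6,10,12)$, $S_{CD}(\alpha,\beta,\gamma,\delta)$ is the elliptic surface with affine equation $z_1^2=y_1^3+(-3\alpha x_1^4-\gamma x_1^5)y_1+(x_1^5-2\beta x_1^6+\delta x_1^7)$ (the Clingher--Doran family). $T_0=\mathbb P(4,6,10,12)-\{\gamma=\delta=0\}$. For $[t]=(t_4:t_6:t_{10}:t_{12}:t_{18})\in\mathbb P(4,6,10,12,18)$, $S([t])$ is the elliptic surface $z^2=y^3+(t_4x^4w^4+t_{10}x^3w^{10})y+(x^7+t_6x^6w^6+t_{12}x^5w^{12}+t_{18}x^4w^{18})$ of weight $42$ in $\mathbb P(6,14,21,1)$, and $T=\{[t]:S([t])\text{ is an elliptic }K3\text{ surface}\}=\{[t]:(t_{10},t_{12},t_{18})\ne(0,0,0)\}$. *)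

(* Defs.v *)
From HB Require Import structures.
From mathcomp Require Import all_boot all_order all_algebra.
From mathcomp Require Import boolp classical_sets reals.
From mathcomp Require Import complex mpoly.

Set Implicit Arguments.
Unset Strict Implicit.
Unset Printing Implicit Defensive.

Import GRing.Theory.

Local Open Scope classical_set_scope.
Local Open Scope ring_scope.

(* Classical (Serre style) varieties: a set of closed points, its Zariski open
   subsets, and on each open U the K-valued functions regular on U. A regular
   function on U is given by a total function whose values off U are
   irrelevant. *)
Record fspace (K : fieldType) := FSpace {
  point :> Type;
  zopen : set (set point);
  regular : set point -> set (point -> K) }.

Arguments zopen {K} _ _.
Arguments regular {K} _ _ _.

Definition zdense (K : fieldType) (X : fspace K) (U : set X) : Prop :=
  forall V, zopen X V -> V !=set0 -> (U `&` V) !=set0.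

Definition irreducible_space (K : fieldType) (X : fspace K) : Prop :=
  [set: X] !=set0 /\
  forall U V, zopen X U -> zopen X V -> U !=set0 -> V !=set0 ->
    (U `&` V) !=set0.

Definition morphism (K : fieldType) (X Y : fspace K) (f : X -> Y) : Prop :=
  forall V, zopen Y V ->
    zopen X (f @^-1` V) /\
    forall h, regular Y V h -> regular X (f @^-1` V) (h \o f).

Definition isomorphism (K : fieldType) (X Y : fspace K) (f : X -> Y) : Prop :=
  morphism f /\ exists g : Y -> X, [/\ morphism g, cancel f g & cancel g f].

Definition isomorphic (K : fieldType) (X Y : fspace K) : Prop :=
  exists f : X -> Y, isomorphism f.

(* For A locally closed in a variety X, this is A with its reduced structure. *)
Definition subspace (K : fieldType) (X : fspace K) (A : set X) : fspace K :=
  @FSpace K {x : X | A x}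
    [set U | exists2 W, zopen X W & U = [set x | W (sval x)]]
    (fun U h => forall x, U x -> exists W g,
       [/\ zopen X W, W (sval x), regular X W g &
           forall y, U y -> W (sval y) -> h y = g (sval y)]).

Definition affine_space (K : fieldType) (n : nat) : fspace K :=
  @FSpace K (n.-tuple K)
    [set U | forall v, U v -> exists f : {mpoly K[n]},
       f.@[tnth v] <> 0 /\ forall u : n.-tuple K, f.@[tnth u] <> 0 -> U u]
    (fun U h => forall v, U v -> exists f g : {mpoly K[n]},
       g.@[tnth v] <> 0 /\
       forall u : n.-tuple K, U u -> g.@[tnth u] <> 0 ->
         h u = f.@[tnth u] / g.@[tnth u]).

Definition whomog (K : fieldType) (n : nat) (w : n.-tuple nat) (d : nat)
    (f : {mpoly K[n]}) : Prop :=
  forall m : 'X_{1..n}, m \in msupp f -> (\sum_i tnth w i * m i)%N = d.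

Definition wscale (K : fieldType) (n : nat) (w : n.-tuple nat) (l : K)
    (v : n.-tuple K) : n.-tuple K :=
  [tuple l ^+ tnth w i * tnth v i | i < n].

(* A point of the weighted projective space is an orbit of K^* on K^n - {0}. *)
Definition wpoint (K : fieldType) (n : nat) (w : n.-tuple nat) : Type :=
  {A : set (n.-tuple K) | exists v : n.-tuple K,
     (exists i, tnth v i <> 0) /\
     A = [set u | exists2 l : K, l <> 0 & u = wscale w l v]}.

Definition hcoord (K : fieldType) (n : nat) (w : n.-tuple nat)
  (p : wpoint K w) : set (n.-tuple K) := sval p.

Definition wproj (K : fieldType) (n : nat) (w : n.-tuple nat) : fspace K :=
  @FSpace K (wpoint K w)
    [set U | forall p, U p -> exists d (f : {mpoly K[n]}),
       [/\ whomog w d f,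
           (forall v, hcoord p v -> f.@[tnth v] <> 0) &
           forall q v, hcoord q v -> f.@[tnth v] <> 0 -> U q]]
    (fun U h => forall p, U p -> exists d (f g : {mpoly K[n]}),
       [/\ whomog w d f, whomog w d g,
           (forall v, hcoord p v -> g.@[tnth v] <> 0) &
           forall q v, U q -> hcoord q v -> g.@[tnth v] <> 0 ->
             h q = f.@[tnth v] / g.@[tnth v]]).

(* To be used with conditions P that are invariant under wscale. *)
Definition wlocus (K : fieldType) (n : nat) (w : n.-tuple nat)
    (P : set (n.-tuple K)) : set (wproj K w) :=
  [set p | exists2 v, hcoord (p : wpoint K w) v & P v].

Definition proj_space (K : fieldType) (n : nat) : fspace K :=
  wproj K [tuple of nseq n.+1 1%N].

Definition P1 (K : fieldType) : fspace K := wproj K [tuple 1%N; 1%N].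

Definition projective_variety (K : fieldType) (X : fspace K) : Prop :=
  exists (n : nat) (A : set (proj_space K n)),
    [/\ zopen (proj_space K n) (~` A), irreducible_space (subspace A) &
        isomorphic X (subspace A)].

(* Jacobian criterion: near each point, X is the zero locus of m polynomials in
   m + 2 variables whose Jacobian matrix has rank m along that locus. *)
Definition nonsingular_surface (K : fieldType) (X : fspace K) : Prop :=
  forall x : X, exists (U : set X) (m : nat) (F : 'I_m -> {mpoly K[m.+2]}),
    let Z : set (affine_space K m.+2) :=
      [set v | forall i, (F i).@[tnth (v : m.+2.-tuple K)] = 0] in
    [/\ zopen X U, U x,
        (forall v : m.+2.-tuple K, Z v ->
           \rank (\matrix_(i < m, j < m.+2) (mderiv j (F i)).@[tnth v]) = m) &
        isomorphic (subspace U) (subspace Z)].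

(* A space with a rational map to P^1, given by its graph: fib x q means that
   the map is defined at x with value q. *)
Record fibred (K : fieldType) := Fibred {
  total :> fspace K;
  fib : total -> P1 K -> Prop }.

Arguments fib {K} _ _ _.

(* The isomorphism g between dense open subsets U and V is a birational map
   X --> Y; it covers sigma on the base. *)
Definition birational_map (K : fieldType) (sigma : P1 K -> P1 K)
    (X Y : fibred K) (U : set X) (V : set Y)
    (g : subspace U -> subspace V) : Prop :=
  [/\ zopen X U, zdense U, zopen Y V, zdense V & isomorphism g] /\
  forall (u : subspace U) q, fib X (sval u) q -> fib Y (sval (g u)) (sigma q).

Definition birational_over (K : fieldType) (sigma : P1 K -> P1 K)
    (X Y : fibred K) : Prop :=
  exists (U : set X) (V : set Y) (g : subspace U -> subspace V),
    birational_map sigma g.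

Definition isomorphic_over (K : fieldType) (sigma : P1 K -> P1 K)
    (X Y : fibred K) : Prop :=
  exists f : X -> Y, isomorphism f /\
    forall x q, fib X x q -> fib Y (f x) (sigma q).

Definition regular_fibred_surface (K : fieldType) (X : fibred K) : Prop :=
  [/\ projective_variety X, nonsingular_surface X &
      exists2 pi : X -> P1 K, morphism pi & forall x q, fib X x q <-> q = pi x].

(* X is the minimal regular model over P^1 of the fibred surface E: every
   birational map to X over P^1 from a regular fibred surface is a morphism.
   When the generic fibre of E has genus one, X is the relatively minimal
   (Kodaira-Neron) elliptic surface with equation E. *)
Definition minimal_model (K : fieldType) (E X : fibred K) : Prop :=
  [/\ regular_fibred_surface X, birational_over id X E &
      forall Y : fibred K, regular_fibred_surface Y ->
      forall (U : set Y) (V : set X) (g : subspace U -> subspace V),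
        birational_map id g ->
        exists2 h : Y -> X, morphism h &
          forall u : subspace U, h (sval u) = sval (g u)].

(* Isomorphism of the elliptic surfaces with equations E and E'. The first
   clause, on the given equations, holds independently of the existence of
   minimal models. *)
Definition elliptic_isomorphic (K : fieldType) (E E' : fibred K) : Prop :=
  exists sigma : P1 K -> P1 K,
    [/\ isomorphism sigma, birational_over sigma E E' &
        forall X X' : fibred K, minimal_model E X -> minimal_model E' X' ->
          isomorphic_over sigma X X'].

(* Coordinates (x_1, y_1, z_1), fibred by x_1. *)
Definition S_CD (K : fieldType) (alpha beta gamma delta : K) : fibred K :=
  let S : set (affine_space K 3) := [set v : 3.-tuple K |
    let x := v`_0 in let y := v`_1 in let z := v`_2 in
    z ^+ 2 = y ^+ 3 + (- (3 * alpha * x ^+ 4) - gamma * x ^+ 5) * y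
      + (x ^+ 5 - 2 * beta * x ^+ 6 + delta * x ^+ 7)] in
  @Fibred K (subspace S)
    (fun p q => hcoord (q : wpoint K _) [tuple (sval p : 3.-tuple K)`_0; 1]).

(* Coordinates (x : y : z : w), fibred by (x : w^6), which is undefined where
   x = w = 0. *)
Definition S_t (K : fieldType) (t4 t6 t10 t12 t18 : K) : fibred K :=
  let S : set (wproj K [tuple 6; 14; 21; 1]%N) :=
    wlocus [set v : 4.-tuple K |
      let x := v`_0 in let y := v`_1 in let z := v`_2 in let w := v`_3 in
      z ^+ 2 = y ^+ 3 + (t4 * x ^+ 4 * w ^+ 4 + t10 * x ^+ 3 * w ^+ 10) * y
        + (x ^+ 7 + t6 * x ^+ 6 * w ^+ 6 + t12 * x ^+ 5 * w ^+ 12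
           + t18 * x ^+ 4 * w ^+ 18)] in
  @Fibred K (subspace S)
    (fun p q => exists2 v, hcoord (sval p : wpoint K _) v &
       hcoord (q : wpoint K _) [tuple v`_0; v`_3 ^+ 6]).

(* Coordinates (alpha : beta : gamma : delta). *)
Definition T0 (K : fieldType) : set (wproj K [tuple 4; 6; 10; 12]%N) :=
  wlocus [set v : 4.-tuple K | ~ (v`_2 = 0 /\ v`_3 = 0)].

(* Coordinates (t4 : t6 : t10 : t12 : t18). *)
Definition T (K : fieldType) : set (wproj K [tuple 4; 6; 10; 12; 18]%N) :=
  wlocus [set v : 5.-tuple K | ~ [/\ v`_2 = 0, v`_3 = 0 & v`_4 = 0]].

Definition T_t18_eq0 (K : fieldType) :
    set (wproj K [tuple 4; 6; 10; 12; 18]%N) :=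
  @T K `&` wlocus [set v : 5.-tuple K | v`_4 = 0].

(* Main.v *)
Require Import Defs.
From HB Require Import structures.
From mathcomp Require Import all_boot all_order all_algebra.
From mathcomp Require Import boolp classical_sets reals.
From mathcomp Require Import complex mpoly.
From mathcomp Require Import ring.

Set Implicit Arguments.
Unset Strict Implicit.
Unset Printing Implicit Defensive.

Import GRing.Theory.

Local Open Scope classical_set_scope.
Local Open Scope ring_scope.

(** The identification of parameters is
      (alpha : beta : gamma : delta) |-> (-3 alpha : -2 beta : -gamma : delta : 0),
    an isomorphism of T0 onto the locus t18 = 0 of T because it is given by forms of
    the right weights, with an inverse of the same kind ([param_isomorphism]).

    For corresponding parameters, dividing the equation of S_CD by x_1^12 and setting
    x = 1 / x_1, y = y_1 / x_1^4, z = z_1 / x_1^6 gives the equation of S_t on the chart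
    w = 1. Coordinates of a point of the weighted projective space are only defined up
    to scaling; this is absorbed by using the chart w = mu instead. The substitution
    is an isomorphism between the open sets x_1 <> 0 and x w <> 0 and covers an
    automorphism sigma of the base, which inverts the coordinate
    ([CD_St_birational], [CD_to_St_fib]). These open sets are dense
    ([CD_dense], [St_dense]): no component of either surface lies in their complements,
    since each point can be moved along a curve z^2 = Q(s) on which a function
    A(s) + B(s) z cannot vanish generically without vanishing everywhere
    ([double_cover_dense]).

    It remains to pass to the minimal models X and X' ([minimal_model_unique]). They
    are birational over sigma. Twisting the fibration of one of them by sigma gives a
    regular fibred surface that is birational over the identity to the other one, so
    by minimality the birational map and its inverse extend to morphisms. Their
    composites are the identity on a dense open set, hence everywhere, as projective
    varieties are separated ([morphism_eq], [projective_separated]); for the same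
    reason the resulting isomorphism covers sigma. The spaces in question
    satisfy the sheaf axioms [ringed], which is what allows morphisms to be restricted,
    composed, lifted and tested locally. *)

(** * Spaces with regular functions *)

Lemma mul_ne0 (K : fieldType) (a b : K) : a * b <> 0 <-> a <> 0 /\ b <> 0.
Proof.
split=> [ab|[/eqP a0 /eqP b0]]; last by apply/eqP; rewrite mulf_neq0.
by split=> e; apply: ab; rewrite e ?mul0r ?mulr0.
Qed.

Lemma expf_mul_eq0 (K : fieldType) (l x : K) k : l <> 0 -> l ^+ k * x = 0 -> x = 0.
Proof.
by move=> /eqP l0 /eqP; rewrite mulf_eq0 (negbTE (expf_neq0 k l0)) => /eqP.
Qed.

(** The sheaf axioms that hold on varieties: the open sets form a topology, given
    here by locality, and the regular functions form a sheaf of K-algebras, in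
    which a nowhere vanishing function is invertible and the nonvanishing locus
    of a function is open. Everything is asked on open sets only. *)
Record ringed (K : fieldType) (X : fspace K) : Prop := Ringed {
  zopenT : zopen X setT;
  zopenI : forall U V, zopen X U -> zopen X V -> zopen X (U `&` V);
  zopen_local : forall U : set X,
    (forall x, U x -> exists W : set X, [/\ zopen X W, W x & W `<=` U]) ->
    zopen X U;
  regular_local : forall (U : set X) (h : X -> K), zopen X U ->
    (forall x, U x -> exists (W : set X) (g : X -> K),
       [/\ zopen X W, W x, regular X W g & forall y, U y -> W y -> h y = g y]) ->
    regular X U h;
  regular_cst : forall (U : set X) c, zopen X U -> regular X U (fun=> c);
  regularD : forall (U : set X) (h k : X -> K), zopen X U ->
    regular X U h -> regular X U k -> regular X U (fun x => h x + k x);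
  regularM : forall (U : set X) (h k : X -> K), zopen X U ->
    regular X U h -> regular X U k -> regular X U (fun x => h x * k x);
  regularV : forall (U : set X) (h : X -> K), zopen X U ->
    regular X U h -> (forall x, U x -> h x <> 0) ->
    regular X U (fun x => (h x)^-1);
  zopen_neq0 : forall (U : set X) (h : X -> K), zopen X U ->
    regular X U h -> zopen X [set x | U x /\ h x <> 0] }.

(** Regularity on U depends only on the values on U, and is inherited by smaller
    open sets. *)
Lemma regular_restrict (K : fieldType) (X : fspace K) (U V : set X)
    (h k : X -> K) :
  ringed X -> zopen X U -> zopen X V -> V `<=` U ->
  (forall x, V x -> k x = h x) -> regular X U h -> regular X V k.
Proof.
move=> rX oU oV VU kh rh; apply: (regular_local rX) => // x Vx.
by exists U, h; split=> //; [exact: VU | move=> y Vy _; exact: kh].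
Qed.

(** The common shape of affine and weighted projective spaces: c p is the set of
    coordinate vectors of the point p, and H d f says that the polynomial f may be
    used in degree d. Affine space has a single vector over each point and no
    condition on f. *)
Definition cone_space (K : fieldType) (T : Type) (n : nat)
    (c : T -> set (n.-tuple K)) (H : nat -> {mpoly K[n]} -> Prop) : fspace K :=
  @FSpace K T
    [set U | forall p, U p -> exists d (f : {mpoly K[n]}),
       [/\ H d f,
           (forall v, c p v -> f.@[tnth v] <> 0) &
           forall q v, c q v -> f.@[tnth v] <> 0 -> U q]]
    (fun U h => forall p, U p -> exists d (f g : {mpoly K[n]}),
       [/\ H d f, H d g,
           (forall v, c p v -> g.@[tnth v] <> 0) &
           forall q v, U q -> c q v -> g.@[tnth v] <> 0 ->
             h q = f.@[tnth v] / g.@[tnth v]]).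

(** The axioms only use that H is a grading: it contains the constants in degree 0
    and is closed under sums and products. *)
Lemma cone_ringed (K : fieldType) (T : Type) (n : nat)
    (c : T -> set (n.-tuple K)) (H : nat -> {mpoly K[n]} -> Prop) :
  (forall p, c p !=set0) ->
  (forall a, H 0%N a%:MP) ->
  (forall d f g, H d f -> H d g -> H d (f + g)) ->
  (forall d e f g, H d f -> H e g -> H (d + e)%N (f * g)) ->
  ringed (cone_space c H).
Proof.
move=> cn0 HC HD HM; split.
- move=> p _; exists 0%N, 1%:MP; split=> // v _; rewrite mevalC.
  exact/eqP/oner_neq0.
- move=> U V oU oV p [Up Vp].
  have [d [f [Hf fp fU]]] := oU p Up; have [e [g [Hg gp gV]]] := oV p Vp.
  exists (d + e)%N, (f * g); split; first exact: HM.
    by move=> v pv; rewrite mevalM mul_ne0; split; [exact: fp | exact: gp].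
  move=> q v qv; rewrite mevalM mul_ne0 => -[fv gv].
  by split; [exact: fU fv | exact: gV gv].
- move=> U oU p Up; have [W [oW Wp WU]] := oU p Up.
  have [d [f [Hf fp fW]]] := oW p Wp.
  by exists d, f; split=> // q v qv fv; apply/WU/(fW q v).
- move=> U h oU hU p Up; have [W [k [oW Wp rk hk]]] := hU p Up.
  have [d [f [Hf fp fW]]] := oW p Wp.
  have [e [a [b [Ha Hb bp kE]]]] := rk p Wp.
  exists (e + d)%N, (a * f), (b * f); split; try exact: HM.
    by move=> v pv; rewrite mevalM mul_ne0; split; [exact: bp | exact: fp].
  move=> q v Uq qv; rewrite !mevalM mul_ne0 => -[bv fv].
  have Wq := fW q v qv fv.
  by rewrite hk // (kE q v) // -mulf_div divff ?mulr1 //; apply/eqP.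
- move=> U a _ p _; exists 0%N, a%:MP, 1%:MP; split=> //.
    by move=> v _; rewrite mevalC; exact/eqP/oner_neq0.
  by move=> q v _ _ _; rewrite !mevalC divr1.
- move=> U h k _ rh rk p Up.
  have [d [a [b [Ha Hb bp hE]]]] := rh p Up.
  have [e [a' [b' [Ha' Hb' bp' kE]]]] := rk p Up.
  exists (d + e)%N, (a * b' + a' * b), (b * b'); split.
  + by apply: HD; [exact: HM | rewrite addnC; exact: HM].
  + exact: HM.
  + by move=> v pv; rewrite mevalM mul_ne0; split; [exact: bp | exact: bp'].
  + move=> q v Uq qv; rewrite mevalD !mevalM mul_ne0 => -[bv bv'].
    by rewrite (hE q v) // (kE q v) // addf_div //; apply/eqP.
- move=> U h k _ rh rk p Up.
  have [d [a [b [Ha Hb bp hE]]]] := rh p Up.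
  have [e [a' [b' [Ha' Hb' bp' kE]]]] := rk p Up.
  exists (d + e)%N, (a * a'), (b * b'); split; try exact: HM.
    by move=> v pv; rewrite mevalM mul_ne0; split; [exact: bp | exact: bp'].
  move=> q v Uq qv; rewrite !mevalM mul_ne0 => -[bv bv'].
  by rewrite (hE q v) // (kE q v) // mulf_div.
- move=> U h _ rh h0 p Up.
  have [d [a [b [Ha Hb bp hE]]]] := rh p Up.
  exists (d + d)%N, (b * b), (a * b); split; try exact: HM.
    move=> v pv; rewrite mevalM mul_ne0; have := h0 p Up.
    by rewrite (hE p v) //; [rewrite mul_ne0 => -[av _]; split=> // | ]; exact: bp.
  move=> q v Uq qv; rewrite !mevalM mul_ne0 => -[/eqP av bv].
  by rewrite (hE q v) // invf_div -mulf_div divff ?mulr1 //; apply/eqP.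
- move=> U h oU rh p [Up hp].
  have [d [f [Hf fp fU]]] := oU p Up.
  have [e [a [b [Ha Hb bp hE]]]] := rh p Up.
  exists (d + (e + e))%N, (f * (a * b)); split;
    first exact: (HM _ _ _ _ Hf (HM _ _ _ _ Ha Hb)).
    move=> v pv; rewrite !mevalM !mul_ne0; split; first exact: fp.
    move: hp; rewrite (hE p v) //; last exact: bp.
    by rewrite mul_ne0 => -[av _]; split=> //; exact: bp.
  move=> q v qv; rewrite !mevalM !mul_ne0 => -[fv [av bv]].
  have Uq := fU q v qv fv; split=> //.
  by rewrite (hE q v) // mul_ne0; split=> //; apply/eqP; rewrite invr_neq0; apply/eqP.
Qed.

Lemma affine_cone (K : fieldType) (n : nat) :
  affine_space K n = cone_space (fun v : n.-tuple K => [set v]) (fun _ _ => True).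
Proof.
congr FSpace.
  apply/funext => U; apply/propext; split=> oU v Uv; have := oU v Uv.
    move=> [f [fv fU]]; exists 0%N, f; split=> // [_ -> //|q _ -> fq].
    exact: fU.
  by move=> [_ [f [_ fv fU]]]; exists f; split=> [|u]; [exact: fv | exact: (fU u u)].
apply/funext => U; apply/funext=> h; apply/propext; split=> oU v Uv; have := oU v Uv.
  move=> [f [g [gv hE]]]; exists 0%N, f, g; split=> // [_ -> //|q _ Uq -> gq].
  exact: hE.
move=> [_ [f [g [_ _ gv hE]]]]; exists f, g; split=> [|u Uu]; first exact: gv.
exact: (hE u u).
Qed.

Lemma affine_ringed (K : fieldType) (n : nat) : ringed (affine_space K n).
Proof. by rewrite affine_cone; apply: cone_ringed => // p; exists p. Qed.

(** * Morphisms *)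

Lemma morphism_comp (K : fieldType) (X Y Z : fspace K) (f : X -> Y) (g : Y -> Z) :
  morphism f -> morphism g -> morphism (g \o f).
Proof.
move=> mf mg V oV; have [oW rW] := mg V oV; have [oU rU] := mf _ oW.
by split=> // h rh; apply: (rU (h \o g)); exact: rW.
Qed.

Lemma morphism_id (K : fieldType) (X : fspace K) : morphism (@id X).
Proof. by move=> V oV; split. Qed.

Lemma morphism_sval (K : fieldType) (X : fspace K) (A : set X) :
  morphism (sval : subspace A -> X).
Proof.
move=> V oV; split; first by exists V.
by move=> h rh x Vx; exists V, h; split.
Qed.

Lemma subspace_ringed (K : fieldType) (X : fspace K) (A : set X) :
  ringed X -> ringed (subspace A).
Proof.
move=> rX.
have op (W : set X) : zopen X W ->
  zopen (subspace A) ([set x | W (sval x)] : set (subspace A)).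
  by exists W.
have opI (U V : set (subspace A)) : zopen (subspace A) U -> zopen (subspace A) V ->
    zopen (subspace A) (U `&` V).
  move=> [W oW ->] [W' oW' ->]; exists (W `&` W') => //; exact: zopenI.
have opl (U : set (subspace A)) :
  (forall x, U x -> exists W : set (subspace A),
    [/\ zopen (subspace A) W, W x & W `<=` U]) -> zopen (subspace A) U.
  move=> lU.
  (* The union of the open sets of X whose trace on A lies in U. *)
  pose O := [set x : X | exists W : set X, [/\ zopen X W, W x &
     forall y : subspace A, W (sval y) -> U y]].
  exists O.
    apply: (zopen_local rX) => x [W [oW Wx WU]].
    by exists W; split=> // y Wy; exists W.
  apply/seteqP; split=> x /=.
    by move=> Ux; have [_ [[W oW ->] Wx WU]] := lU x Ux; exists W.
  by move=> [W [_ Wx]]; apply.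
split=> //.
- by exists setT => //; exact: zopenT.
- move=> U h oU lU x Ux.
  have [W [g [[W' oW' WE] Wx rg hg]]] := lU x Ux; rewrite {}WE in Wx rg hg.
  have [V [k [oV Vx rk gk]]] := rg x Wx.
  have oWV : zopen X (W' `&` V) by exact: zopenI.
  exists (W' `&` V), k; split=> //; first exact: (regular_restrict rX oV oWV).
  by move=> y Uy [Wy Vy]; rewrite hg // gk.
- by move=> U c _ x _; exists setT, (fun=> c); split=> //;
    [exact: zopenT | apply: regular_cst => //; exact: zopenT].
- move=> U h k _ rh rk x Ux.
  have [W [h' [oW Wx rh' hE]]] := rh x Ux.
  have [V [k' [oV Vx rk' kE]]] := rk x Ux.
  have oWV : zopen X (W `&` V) by exact: zopenI.
  exists (W `&` V), (fun x => h' x + k' x); split=> //.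
    apply: regularD => //; [apply: regular_restrict rh' | apply: regular_restrict rk'];
      by move=> // ? [].
  by move=> y Uy [Wy Vy]; rewrite hE // kE.
- move=> U h k _ rh rk x Ux.
  have [W [h' [oW Wx rh' hE]]] := rh x Ux.
  have [V [k' [oV Vx rk' kE]]] := rk x Ux.
  have oWV : zopen X (W `&` V) by exact: zopenI.
  exists (W `&` V), (fun x => h' x * k' x); split=> //.
    apply: regularM => //; [apply: regular_restrict rh' | apply: regular_restrict rk'];
      by move=> // ? [].
  by move=> y Uy [Wy Vy]; rewrite hE // kE.
- move=> U h _ rh h0 x Ux.
  have [W [h' [oW Wx rh' hE]]] := rh x Ux.
  have oD := zopen_neq0 rX oW rh'.
  exists [set x | W x /\ h' x <> 0], (fun x => (h' x)^-1); split=> //.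
  + by split=> //; rewrite -hE //; exact: h0.
  + apply: regularV => //; last by move=> ? [].
    by apply: regular_restrict rh' => // ? [].
  + by move=> y Uy [Wy _]; rewrite hE.
- move=> U h oU rh; apply: opl => x [Ux hx].
  have [W [h' [oW Wx rh' hE]]] := rh x Ux.
  exists (U `&` [set y | (W (sval y)) /\ h' (sval y) <> 0]); split.
  + by apply: opI => //; exact: (op _ (zopen_neq0 rX oW rh')).
  + by split=> //; split=> //; rewrite -hE.
  + by move=> y [Uy [Wy hy]]; split=> //; rewrite hE.
Qed.

(** The structure of ringed space transfers along an isomorphism. *)
Lemma isomorphic_ringed (K : fieldType) (X Y : fspace K) :
  isomorphic X Y -> ringed Y -> ringed X.
Proof.
move=> [f [mf [g [mg fK gK]]]] rY.
have opE (U : set X) : zopen X U <-> zopen Y (g @^-1` U).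
  split; first by move=> oU; exact: (mg U oU).1.
  move=> /mf[oU _]; rewrite (_ : U = f @^-1` (g @^-1` U)) //.
  by apply/funext => x /=; rewrite /preimage /= fK.
have rE (U : set X) (h : X -> K) : zopen X U ->
    regular X U h <-> regular Y (g @^-1` U) (h \o g).
  move=> oU; split; first exact: (mg U oU).2.
  move=> /((mf _ ((opE U).1 oU)).2 _).
  rewrite (_ : f @^-1` (g @^-1` U) = U); last first.
    by apply/funext => x /=; rewrite /preimage /= fK.
  by rewrite (_ : (h \o g) \o f = h) //; apply/funext => x /=; rewrite fK.
split.
- by apply/opE; exact: zopenT.
- by move=> U V /opE oU /opE oV; apply/opE; exact: zopenI.
- move=> U lU; apply/opE; apply: (zopen_local rY) => y Uy.
  have [W [/opE oW Wy WU]] := lU _ Uy.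
  by exists (g @^-1` W); split=> // z; exact: WU.
- move=> U h oU lU; apply/(rE _ _ oU); apply: (regular_local rY); first exact/opE.
  move=> y Uy; have [W [k [oW Wy rk hk]]] := lU _ Uy.
  exists (g @^-1` W), (k \o g); split=> //; first exact/opE.
    exact/(rE _ _ oW).
  by move=> z Uz Wz /=; rewrite hk.
- by move=> U c oU; apply/(rE _ _ oU); apply: (regular_cst rY); exact/opE.
- move=> U h k oU /(rE _ _ oU) rh /(rE _ _ oU) rk; apply/(rE _ _ oU).
  by apply: (regularD rY) => //; exact/opE.
- move=> U h k oU /(rE _ _ oU) rh /(rE _ _ oU) rk; apply/(rE _ _ oU).
  by apply: (regularM rY) => //; exact/opE.
- move=> U h oU /(rE _ _ oU) rh h0; apply/(rE _ _ oU).
  by apply: (regularV rY) => //; [exact/opE | move=> y; exact: h0].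
- move=> U h oU /(rE _ _ oU) rh; apply/opE.
  by apply: (zopen_neq0 rY) => //; exact/opE.
Qed.

(** The restriction to the subspace A of the total function f is a morphism; the
    values of f off A are irrelevant. *)
Definition mor_on (K : fieldType) (X Y : fspace K) (A : set X) (f : X -> Y) :=
  morphism (fun x : subspace A => f (sval x)).

(** A map into a subspace is a morphism as soon as it is one into the ambient
    space. *)
Lemma morphism_lift (K : fieldType) (X Y : fspace K) (B : set Y)
    (f : X -> subspace B) :
  ringed X -> morphism (fun x => sval (f x)) -> morphism f.
Proof.
move=> rX mf V oV; have [W oW VE] := oV.
have oU : zopen X (f @^-1` V) by rewrite VE; exact: (mf W oW).1.
split=> // h rh; apply: (regular_local rX) => // x Vx.
have [W' [g [oW' Wx rg hg]]] := rh _ Vx.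
have [oN rN] := mf W' oW'.
exists (fun x => W' (sval (f x))), (fun x => g (sval (f x))); split=> //.
  exact: (rN g).
by move=> y Vy Wy; exact: hg.
Qed.

Lemma mor_on_sub (K : fieldType) (X Y : fspace K) (A B : set X) (f : X -> Y) :
  ringed X -> B `<=` A -> mor_on A f -> mor_on B f.
Proof.
move=> rX BA mf.
pose i (x : subspace B) : subspace A := exist _ (sval x) (BA _ (svalP x)).
have mi : morphism i by apply: morphism_lift;
  [exact: subspace_ringed | exact: morphism_sval].
exact: morphism_comp mi mf.
Qed.

Lemma mor_on_lift (K : fieldType) (X Y : fspace K) (A : set X) (B : set Y)
    (f : X -> Y) (g : subspace A -> subspace B) :
  ringed X -> (forall x, sval (g x) = f (sval x)) -> mor_on A f -> morphism g.
Proof.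
move=> rX gf mf; apply: morphism_lift; first exact: subspace_ringed.
by rewrite (_ : (fun x => sval (g x)) = fun x => f (sval x)) //; apply/funext.
Qed.

Lemma mor_on_comp (K : fieldType) (X Y Z : fspace K) (A : set X) (B : set Y)
    (f : X -> Y) (g : Y -> Z) :
  ringed X -> mor_on A f -> mor_on B g -> (forall x, A x -> B (f x)) ->
  mor_on A (g \o f).
Proof.
move=> rX mf mg fAB.
pose i (x : subspace A) : subspace B := exist _ (f (sval x)) (fAB _ (svalP x)).
have mi : morphism i by apply: (mor_on_lift rX _ mf).
exact: morphism_comp mi mg.
Qed.

Lemma mor_onT (K : fieldType) (X Y : fspace K) (f : X -> Y) :
  ringed X -> mor_on setT f -> morphism f.
Proof.
move=> rX mf; pose i (x : X) : subspace [set: X] := exist _ x Logic.I.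
have mi : morphism i by apply: morphism_lift => //; exact: morphism_id.
exact: morphism_comp mi mf.
Qed.

Lemma zopen_subspace (K : fieldType) (X : fspace K) (A : set X)
    (O : set (subspace A)) :
  ringed X -> zopen X A -> zopen (subspace A) O ->
  zopen X [set x | exists Ax : A x, O (exist _ x Ax)].
Proof.
move=> rX oA [W oW ->].
rewrite (_ : [set x | _] = A `&` W); first exact: zopenI.
by apply/seteqP; split=> x /= [Ax Wx]; [split | exists Ax].
Qed.

Lemma mor_on_zopen (K : fieldType) (X Y : fspace K) (A : set X) (f : X -> Y)
    (V : set Y) :
  ringed X -> zopen X A -> mor_on A f -> zopen Y V -> zopen X (A `&` f @^-1` V).
Proof.
move=> rX oA mf /mf[oV _]; have := zopen_subspace rX oA oV.
by congr zopen; apply/seteqP; split=> x /= [Ax Wx]; [split | exists Ax].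
Qed.

Lemma regular_pull (K : fieldType) (X Y : fspace K) (V : set Y) (h : Y -> K)
    (i : X -> Y) :
  morphism i -> zopen Y V -> regular Y V h -> (forall x, V (i x)) ->
  regular X setT (h \o i).
Proof.
move=> mi oV rh iV; have [_ rV] := mi V oV.
by rewrite (_ : setT = i @^-1` V); [exact: rV | apply/seteqP; split=> x //= _; exact: iV].
Qed.

(** * Separation *)

(** Any two distinct points lie in an open set on which some regular function
    takes different values at them. *)
Definition separated (K : fieldType) (X : fspace K) : Prop :=
  forall a b : X, a <> b -> exists (W : set X) (h : X -> K),
    [/\ zopen X W, W a, W b, regular X W h & h a <> h b].

Lemma subspace_separated (K : fieldType) (X : fspace K) (A : set X) :
  separated X -> separated (subspace A).
Proof.
move=> sX a b ab.
have [|W [h [oW Wa Wb rh hab]]] := sX (sval a) (sval b).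
  by move=> e; apply: ab; case: a b e => [a Aa] [b Ab] /= e; exact: eq_exist.
have [oV rV] := @morphism_sval K X A W oW.
by exists (fun x => W (sval x)), (fun x => h (sval x)); split=> //; exact: rV.
Qed.

Lemma isomorphic_separated (K : fieldType) (X Y : fspace K) :
  isomorphic X Y -> separated Y -> separated X.
Proof.
move=> [f [mf [g [mg fK gK]]]] sY a b ab.
have [|W [h [oW Wa Wb rh hab]]] := sY (f a) (f b).
  by move=> /(can_inj fK).
have [oV rV] := mf W oW.
by exists (f @^-1` W), (h \o f); split=> //; exact: rV.
Qed.

(** Morphisms to a separated space are determined by their values on a dense set:
    if f x and g x were separated by h, then h (f y) <> h (g y) would define a
    nonempty open set, missing the dense one. *)
Lemma morphism_eq (K : fieldType) (X Y : fspace K) (D : set X) (f g : X -> Y) :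
  ringed X -> separated Y -> morphism f -> morphism g -> zdense D ->
  (forall x, D x -> f x = g x) -> forall x, f x = g x.
Proof.
move=> rX sY mf mg dD fg x; apply: contrapT => ne.
have [W [h [oW Wf Wg rh hne]]] := sY _ _ ne.
have [oU rU] := mf W oW; have [oV rV] := mg W oW.
have oUV := zopenI rX oU oV.
have rd : regular X (f @^-1` W `&` g @^-1` W) (fun x => h (f x) + -1 * h (g x)).
  apply: regularD => //.
    apply: regular_restrict (rU h rh) => //; by move=> ? [].
  apply: regularM => //; first exact: regular_cst.
  by apply: regular_restrict (rV h rh) => //; move=> ? [].
have [|y [Dy [_ yne]]] := dD _ (zopen_neq0 rX oUV rd).
  by exists x; split=> //= e; apply: hne; apply/eqP; rewrite -subr_eq0 -mulN1r e.
by apply: yne => /=; rewrite fg // mulN1r subrr.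
Qed.

(** * Polynomials and weighted forms *)

Lemma mevalXn (K : fieldType) (n k : nat) (v : 'I_n -> K) (f : {mpoly K[n]}) :
  (f ^+ k).@[v] = f.@[v] ^+ k.
Proof. by elim: k => [|k IHk]; rewrite ?expr0 ?rmorph1 // !exprS mevalM IHk. Qed.

Lemma tuple3E (K : nzRingType) (v : 3.-tuple K) : v = [tuple v`_0; v`_1; v`_2].
Proof. by case: v => -[|a [|b [|c []]]] // i; exact: val_inj. Qed.

Lemma tuple4E (K : nzRingType) (v : 4.-tuple K) :
  v = [tuple v`_0; v`_1; v`_2; v`_3].
Proof. by case: v => -[|a [|b [|c [|d []]]]] // i; exact: val_inj. Qed.

(** Induction on polynomials as elements of the algebra generated by the
    variables. *)
Lemma mpoly_ring_ind (K : fieldType) (n : nat) (P : {mpoly K[n]} -> Prop) :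
  (forall c, P c%:MP) -> (forall i, P 'X_i) ->
  (forall f g, P f -> P g -> P (f + g)) ->
  (forall f g, P f -> P g -> P (f * g)) -> forall f, P f.
Proof.
move=> PC PX PD PM f; rewrite [f]mpolyE.
elim/big_ind: _ => [||m _]; [by rewrite -mpolyC0 | by [] | ].
rewrite -mul_mpolyC; apply: (PM) => //; rewrite mpolyXE_id.
elim/big_ind: _ => [||i _]; [by rewrite -mpolyC1 | exact: PM | ].
elim: (m i) => [|k IHk]; first by rewrite expr0 -mpolyC1.
by rewrite exprS; apply: PM.
Qed.

Lemma whomogC (K : fieldType) (n : nat) (w : n.-tuple nat) (c : K) :
  whomog w 0 (c%:MP : {mpoly K[n]}).
Proof.
move=> m; rewrite msuppC; case: ifP => // _; rewrite inE => /eqP ->.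
by rewrite big1 // => i _; rewrite mnm0E muln0.
Qed.

Lemma whomogX (K : fieldType) (n : nat) (w : n.-tuple nat) (i : 'I_n) :
  whomog w (tnth w i) ('X_i : {mpoly K[n]}).
Proof.
move=> m; rewrite msuppX inE => /eqP ->.
rewrite (bigD1 i) //= mnm1E eqxx muln1 big1 ?addn0 // => j ji.
by rewrite mnm1E eq_sym (negbTE ji) muln0.
Qed.

Lemma whomogD (K : fieldType) (n : nat) (w : n.-tuple nat) d
    (f g : {mpoly K[n]}) : whomog w d f -> whomog w d g -> whomog w d (f + g).
Proof. by move=> hf hg m /msuppD_le; rewrite mem_cat => /orP[/hf|/hg]. Qed.

Lemma whomogM (K : fieldType) (n : nat) (w : n.-tuple nat) d e
    (f g : {mpoly K[n]}) :
  whomog w d f -> whomog w e g -> whomog w (d + e) (f * g).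
Proof.
move=> hf hg m /msuppM_le/allpairsP[[m1 m2] /= [/hf <- /hg <- ->]].
by rewrite -big_split /=; apply: eq_bigr => i _; rewrite mnmDE mulnDr.
Qed.

Lemma whomogZ (K : fieldType) (n : nat) (w : n.-tuple nat) d c
    (f : {mpoly K[n]}) : whomog w d f -> whomog w d (c *: f).
Proof. by move=> hf; rewrite -mul_mpolyC -[d]add0n; apply: whomogM hf; exact: whomogC. Qed.

Lemma whomogXn (K : fieldType) (n : nat) (w : n.-tuple nat) d k
    (f : {mpoly K[n]}) : whomog w d f -> whomog w (d * k) (f ^+ k).
Proof.
move=> hf; elim: k => [|k IHk]; first by rewrite muln0 expr0 -mpolyC1; exact: whomogC.
by rewrite mulnS exprS; apply: whomogM.
Qed.

Lemma whomog0 (K : fieldType) (n : nat) (w : n.-tuple nat) d :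
  whomog w d (0 : {mpoly K[n]}).
Proof. by move=> m; rewrite msupp0. Qed.

Lemma whomog_comp (K : fieldType) (n m : nat) (w : n.-tuple nat)
    (w' : m.-tuple nat) (F : m.-tuple {mpoly K[n]}) d (f : {mpoly K[m]}) :
  (forall i, whomog w (tnth w' i) (tnth F i)) ->
  whomog w' d f -> whomog w d (f \mPo F).
Proof.
move=> hF hf; rewrite comp_mpolyE big_seq.
elim/big_ind: _ => [||mm /hf <-]; [exact: whomog0 | exact: whomogD | ].
apply: whomogZ; elim/big_ind2: _ => [|d1 f1 d2 f2|i _].
- by rewrite -mpolyC1; exact: whomogC.
- exact: whomogM.
- exact: whomogXn.
Qed.

Lemma whomog_eval (K : fieldType) (n : nat) (w : n.-tuple nat) d
    (f : {mpoly K[n]}) l (v : n.-tuple K) :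
  whomog w d f -> f.@[tnth (wscale w l v)] = l ^+ d * f.@[tnth v].
Proof.
move=> hf; rewrite !mevalE mulr_sumr !big_seq; apply: eq_bigr => m /hf <-.
rewrite mulrCA; congr (_ * _); rewrite -prodrXr -big_split /=.
by apply: eq_bigr => i _; rewrite tnth_mktuple exprMn exprM.
Qed.

(** * Weighted projective spaces *)

Lemma wscale1 (K : fieldType) (n : nat) (w : n.-tuple nat) (v : n.-tuple K) :
  wscale w 1 v = v.
Proof. by apply: eq_from_tnth => i; rewrite tnth_mktuple expr1n mul1r. Qed.

Lemma wscaleA (K : fieldType) (n : nat) (w : n.-tuple nat) (v : n.-tuple K) l m :
  wscale w l (wscale w m v) = wscale w (l * m) v.
Proof. by apply: eq_from_tnth => i; rewrite !tnth_mktuple exprMn mulrA. Qed.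

Lemma tnth_wscale (K : fieldType) (n : nat) (w : n.-tuple nat) (v : n.-tuple K) l
    i : tnth (wscale w l v) i = l ^+ (nth 0%N w i) * v`_i.
Proof. by rewrite tnth_mktuple (tnth_nth 0 v) (tnth_nth 0%N w). Qed.

Lemma wscale_nth (K : fieldType) (n : nat) (w : n.-tuple nat) (v : n.-tuple K) l
    i : (i < n)%N -> (wscale w l v)`_i = l ^+ (nth 0%N w i) * v`_i.
Proof.
by move=> i_n; rewrite -(tnth_nth 0 _ (Ordinal i_n)) tnth_wscale.
Qed.

Lemma hcoord_ex (K : fieldType) (n : nat) (w : n.-tuple nat) (p : wpoint K w) :
  exists v, hcoord p v.
Proof.
case: p => A [v [v0 AE]]; exists v; rewrite /hcoord /= AE.
by exists 1; [exact/eqP/oner_neq0 | rewrite wscale1].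
Qed.

Lemma hcoord_scale (K : fieldType) (n : nat) (w : n.-tuple nat)
    (p : wpoint K w) v l : l <> 0 -> hcoord p v -> hcoord p (wscale w l v).
Proof.
case: p => A [u [u0 AE]]; rewrite /hcoord /= AE => l0 [m m0 ->].
by exists (l * m); [rewrite mul_ne0 | rewrite wscaleA].
Qed.

Lemma hcoord_orbit (K : fieldType) (n : nat) (w : n.-tuple nat)
    (p : wpoint K w) v u :
  hcoord p v -> hcoord p u -> exists2 l, l <> 0 & u = wscale w l v.
Proof.
case: p => A [a [a0 AE]]; rewrite /hcoord /= AE => -[m /eqP m0 ->] [l /eqP l0 ->].
exists (l / m); first by apply/eqP; rewrite mulf_neq0 ?invr_neq0.
by rewrite wscaleA divfK.
Qed.

Lemma hcoord_eq (K : fieldType) (n : nat) (w : n.-tuple nat)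
    (p : wpoint K w) v u : hcoord p v -> v = u -> hcoord p u.
Proof. by move=> pv <-. Qed.

Lemma hcoord_inj (K : fieldType) (n : nat) (w : n.-tuple nat)
    (p q : wpoint K w) v : hcoord p v -> hcoord q v -> p = q.
Proof.
move=> pv qv; suff E : sval p = sval q.
  by case: p q E {pv qv} => [A a] [B b] /= E; exact: eq_exist.
apply/seteqP; split=> u pu.
  by have [l l0 ->] := hcoord_orbit pv pu; exact: hcoord_scale.
by have [l l0 ->] := hcoord_orbit qv pu; exact: hcoord_scale.
Qed.

Lemma hcoord_neq0 (K : fieldType) (n : nat) (w : n.-tuple nat)
    (p : wpoint K w) v : hcoord p v -> exists i, tnth v i <> 0.
Proof.
case: p => A [a [[i ai] AE]]; rewrite /hcoord /= AE => -[m m0 ->].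
exists i; rewrite tnth_mktuple mul_ne0; split=> //.
by apply/eqP; rewrite expf_neq0 //; apply/eqP.
Qed.

(** The point with homogeneous coordinates v. *)
Definition wpt (K : fieldType) (n : nat) (w : n.-tuple nat) (v : n.-tuple K)
    (v0 : exists i, tnth v i <> 0) : wpoint K w :=
  exist _ [set u | exists2 l : K, l <> 0 & u = wscale w l v]
    (ex_intro _ v (conj v0 erefl)).

Lemma hcoord_wpt (K : fieldType) (n : nat) (w : n.-tuple nat) (v : n.-tuple K)
    (v0 : exists i, tnth v i <> 0) : hcoord (wpt w v0) v.
Proof. by exists 1; [exact/eqP/oner_neq0 | rewrite wscale1]. Qed.

(** A choice of homogeneous coordinates of p. *)
Definition hrep (K : fieldType) (n : nat) (w : n.-tuple nat) (p : wpoint K w) :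
  n.-tuple K := projT1 (cid (hcoord_ex p)).

Lemma hcoord_hrep (K : fieldType) (n : nat) (w : n.-tuple nat)
    (p : wpoint K w) : hcoord p (hrep p).
Proof. exact: (projT2 (cid (hcoord_ex p))). Qed.

Lemma wproj_ringed (K : fieldType) (n : nat) (w : n.-tuple nat) :
  ringed (wproj K w).
Proof.
apply: (@cone_ringed K (wpoint K w) n (@hcoord K n w) (@whomog K n w)).
- exact: hcoord_ex.
- exact: whomogC.
- exact: whomogD.
- exact: whomogM.
Qed.

(** The principal open set f <> 0. *)
Definition wD (K : fieldType) (n : nat) (w : n.-tuple nat) (f : {mpoly K[n]}) :
  set (wproj K w) := [set p | f.@[tnth (hrep (p : wpoint K w))] <> 0].
Arguments wD {K n} w f.

Lemma wDE (K : fieldType) (n : nat) (w : n.-tuple nat) d (f : {mpoly K[n]})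
    (p : wpoint K w) v :
  whomog w d f -> hcoord p v -> wD w f p <-> f.@[tnth v] <> 0.
Proof.
move=> hf pv; rewrite /wD /=.
have [l /eqP l0 ->] := hcoord_orbit (hcoord_hrep p) pv.
rewrite (whomog_eval _ _ hf) mul_ne0; split=> [|[]] //; split=> //.
by apply/eqP; rewrite expf_neq0.
Qed.

Lemma zopen_wD (K : fieldType) (n : nat) (w : n.-tuple nat) d (f : {mpoly K[n]}) :
  whomog w d f -> zopen (wproj K w) (wD w f).
Proof.
move=> hf p pf; exists d, f; split=> // [v pv|q v qv fv].
  by apply/(wDE hf pv).
exact/(wDE hf qv).
Qed.

(** The quotient f / g of two forms of the same degree. *)
Definition wratio (K : fieldType) (n : nat) (w : n.-tuple nat)
    (f g : {mpoly K[n]}) (p : wproj K w) : K :=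
  let v := hrep (p : wpoint K w) in f.@[tnth v] / g.@[tnth v].
Arguments wratio {K n} w f g p.

Lemma wratioE (K : fieldType) (n : nat) (w : n.-tuple nat) d
    (f g : {mpoly K[n]}) (p : wpoint K w) v :
  whomog w d f -> whomog w d g -> hcoord p v ->
  wratio w f g p = f.@[tnth v] / g.@[tnth v].
Proof.
move=> hf hg pv; rewrite /wratio.
have [l /eqP l0 ->] := hcoord_orbit (hcoord_hrep p) pv.
by rewrite (whomog_eval _ _ hf) (whomog_eval _ _ hg) -mulf_div divff ?mul1r ?expf_neq0.
Qed.

Lemma regular_wratio (K : fieldType) (n : nat) (w : n.-tuple nat) d
    (f g : {mpoly K[n]}) :
  whomog w d f -> whomog w d g -> regular (wproj K w) (wD w g) (wratio w f g).
Proof.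
move=> hf hg p pg; exists d, f, g; split=> // [v pv|q v qg qv gv].
  by apply/(wDE hg pv).
exact: (wratioE hf hg qv).
Qed.

(** A map between weighted projective spaces is a morphism on A when it is given
    there by forms of the appropriate degrees. *)
Lemma wproj_mor_on (K : fieldType) (n m : nat) (w : n.-tuple nat)
    (w' : m.-tuple nat) (A : set (wproj K w)) (F : m.-tuple {mpoly K[n]})
    (f : wproj K w -> wproj K w') :
  (forall i, whomog w (tnth w' i) (tnth F i)) ->
  (forall (p : wpoint K w) v, A p -> hcoord p v ->
     hcoord (f p : wpoint K w') [tuple (tnth F i).@[tnth v] | i < m]) ->
  mor_on A f.
Proof.
move=> hF fF.
have rS : ringed (subspace A) by apply: subspace_ringed; exact: wproj_ringed.
have ev (g : {mpoly K[m]}) (v : n.-tuple K) :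
    (g \mPo F).@[tnth v] = g.@[tnth [tuple (tnth F i).@[tnth v] | i < m]].
  rewrite comp_mpoly_meval; congr (meval _ g).
  by apply/funext => i; rewrite tnth_mktuple.
have opn d (g : {mpoly K[m]}) : whomog w' d g ->
    zopen (subspace A) [set x : subspace A | wD w (g \mPo F) (sval x)].
  by move=> hg; exists (wD w (g \mPo F)) => //; apply: zopen_wD; exact: whomog_comp hg.
have inD d (g : {mpoly K[m]}) (x : subspace A) : whomog w' d g ->
    wD w (g \mPo F) (sval x) <-> wD w' g (f (sval x)).
  move=> hg; have Fx := fF _ _ (svalP x) (hcoord_hrep (sval x)).
  by rewrite (wDE hg Fx) -ev.
move=> V oV; split.
  apply: (zopen_local rS) => x Vx; have [d [g [hg gx gV]]] := oV _ Vx.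
  exists [set x : subspace A | wD w (g \mPo F) (sval x)]; split.
  - exact: opn hg.
  - apply/(inD _ _ _ hg)/gx; exact: hcoord_hrep.
  - move=> y /(inD _ _ _ hg) gy; apply: gV gy; exact: hcoord_hrep.
move=> h rh x Vx; have [d [a [b [ha hb bx hE]]]] := rh _ Vx.
have [hac hbc] := (whomog_comp hF ha, whomog_comp hF hb).
exists (wD w (b \mPo F)), (wratio w (a \mPo F) (b \mPo F)); split.
- exact: zopen_wD hbc.
- apply/(inD _ _ _ hb)/bx; exact: hcoord_hrep.
- exact: regular_wratio hac hbc.
- move=> y Vy /= by0.
  have Fy := fF _ _ (svalP y) (hcoord_hrep (sval y)).
  by rewrite (hE _ _ Vy Fy) -!ev.
Qed.

Lemma regular_meval (K : fieldType) (X : fspace K) (n : nat) (U : set X)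
    (F : 'I_n -> X -> K) (f : {mpoly K[n]}) :
  ringed X -> zopen X U -> (forall i, regular X U (F i)) ->
  regular X U (fun x => f.@[fun i => F i x]).
Proof.
move=> rX oU rF.
have ext (h k : X -> K) : regular X U h -> (forall x, k x = h x) -> regular X U k.
  by move=> rh kh; rewrite (_ : k = h) //; exact/funext.
elim/mpoly_ring_ind: f => [c|i|f g|f g].
- by apply: (ext _ _ (regular_cst rX c oU)) => x; rewrite mevalC.
- by apply: (ext _ _ (rF i)) => x; rewrite mevalXU.
- by move=> rf rg; apply: (ext _ _ (regularD rX oU rf rg)) => x; rewrite mevalD.
- by move=> rf rg; apply: (ext _ _ (regularM rX oU rf rg)) => x; rewrite mevalM.
Qed.

Lemma regular_mpoly (K : fieldType) (n : nat) (f : {mpoly K[n]}) :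
  regular (affine_space K n) setT (fun v => f.@[tnth v]).
Proof.
move=> v _; exists f, 1%:MP; split.
  by rewrite mevalC; exact/eqP/oner_neq0.
by move=> u _ _; rewrite mevalC divr1.
Qed.

Lemma zopen_neq0T (K : fieldType) (X : fspace K) (h : X -> K) :
  ringed X -> regular X setT h -> zopen X [set x | h x <> 0].
Proof.
move=> rX rh; have := zopen_neq0 rX (zopenT rX) rh; congr zopen.
by apply/seteqP; split=> x /= => [[]|hx].
Qed.

Lemma tnth_funE (K : Type) (n : nat) (F : 'I_n -> K) :
  tnth [tuple F i | i < n] = F.
Proof. by apply/funext => i; rewrite tnth_mktuple. Qed.

(** Regular functions that are homogeneous coordinates of f x at each point x make
    f a morphism. *)
Lemma morphism_wproj (K : fieldType) (X : fspace K) (n : nat) (w : n.-tuple nat)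
    (F : 'I_n -> X -> K) (f : X -> wproj K w) :
  ringed X -> (forall i, regular X setT (F i)) ->
  (forall x, hcoord (f x : wpoint K w) [tuple F i x | i < n]) -> morphism f.
Proof.
move=> rX rF fF; have oT := zopenT rX.
have rg g := regular_meval g rX oT rF.
have og (g : {mpoly K[n]}) : zopen X [set x | g.@[fun i => F i x] <> 0].
  exact: zopen_neq0T.
move=> V oV.
have oU : zopen X (f @^-1` V).
  apply: (zopen_local rX) => x Vx; have [d [g [hg gx gV]]] := oV _ Vx.
  exists [set x | g.@[fun i => F i x] <> 0]; split=> //.
    by have := gx _ (fF x); rewrite tnth_funE.
  by move=> y gy; apply: gV (fF y) _; rewrite tnth_funE.
split=> // h rh; apply: (regular_local rX) => // x Vx.
have [d [a [b [ha hb bx hE]]]] := rh _ Vx.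
have oB := og b; have sB : [set x | b.@[fun i => F i x] <> 0] `<=` setT by [].
exists [set x | b.@[fun i => F i x] <> 0],
  (fun x => a.@[fun i => F i x] * (b.@[fun i => F i x])^-1); split=> //.
- by have := bx _ (fF x); rewrite tnth_funE.
- apply: regularM => //; first exact: (regular_restrict rX oT oB sB _ (rg a)).
  by apply: regularV => //; exact: (regular_restrict rX oT oB sB _ (rg b)).
- by move=> y Vy by0; have := hE _ _ Vy (fF y); rewrite tnth_funE; apply.
Qed.

Lemma morphism_affine (K : fieldType) (X : fspace K) (n : nat)
    (f : X -> affine_space K n) :
  ringed X -> (forall i, regular X setT (fun x => tnth (f x) i)) -> morphism f.
Proof.
move=> rX rF; have oT := zopenT rX.
have rg g := regular_meval g rX oT rF.
have og (g : {mpoly K[n]}) : zopen X [set x | g.@[tnth (f x)] <> 0].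
  exact: zopen_neq0T.
move=> V oV.
have oU : zopen X (f @^-1` V).
  apply: (zopen_local rX) => x Vx; have [g [gx gV]] := oV _ Vx.
  by exists [set x | g.@[tnth (f x)] <> 0]; split=> // y gy; exact: gV.
split=> // h rh; apply: (regular_local rX) => // x Vx.
have [a [b [bx hE]]] := rh _ Vx.
have oB := og b; have sB : [set x | b.@[tnth (f x)] <> 0] `<=` setT by [].
exists [set x | b.@[tnth (f x)] <> 0],
  (fun x => a.@[tnth (f x)] * (b.@[tnth (f x)])^-1); split=> //.
- apply: regularM => //.
    exact: (regular_restrict rX oT oB sB _ (rg a)).
  by apply: regularV => //; exact: (regular_restrict rX oT oB sB _ (rg b)).
- by move=> y Vy by0; exact: hE.
Qed.

(** Two points of P^n are separated by x_i / L for a linear form L not vanishing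
    at either of them. *)
Lemma wproj_separated (K : fieldType) (n : nat) (w : n.-tuple nat) :
  (forall i, tnth w i = 1%N) -> separated (wproj K w).
Proof.
move=> w1 a b ab.
have [va vb] := (hcoord_hrep a, hcoord_hrep b).
set u := hrep a in va; set v := hrep b in vb.
have hX (i : 'I_n) : whomog w 1 ('X_i : {mpoly K[n]}).
  by rewrite -(w1 i); exact: whomogX.
have [L [hL Lu Lv]] : exists L : {mpoly K[n]},
    [/\ whomog w 1 L, L.@[tnth u] <> 0 & L.@[tnth v] <> 0].
  have [i ui] := hcoord_neq0 va; have [j vj] := hcoord_neq0 vb.
  have [vi|/eqP vi] := eqVneq (tnth v i) 0; last first.
    by exists 'X_i; rewrite !mevalXU; split=> //.
  have [uj|/eqP uj] := eqVneq (tnth u j) 0; last first.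
    by exists 'X_j; rewrite !mevalXU; split=> //.
  (* Here u_i and v_j are nonzero, and v_i = u_j = 0. *)
  exists ('X_i + 'X_j); rewrite !mevalD !mevalXU vi uj addr0 add0r; split=> //.
  exact: whomogD.
have [i ne] : exists i, tnth u i / L.@[tnth u] <> tnth v i / L.@[tnth v].
  apply: contrapT => /forallNP E; apply: ab; apply: (hcoord_inj (v := v)) => //.
  rewrite (_ : v = wscale w (L.@[tnth v] / L.@[tnth u]) u).
    by apply: hcoord_scale => //; apply/eqP; rewrite mulf_neq0 ?invr_neq0 //; exact/eqP.
  apply: eq_from_tnth => i; rewrite tnth_mktuple w1 expr1.
  have /contrapT E1 := E i.
  by rewrite mulrAC -mulrA E1 mulrC divfK //; apply/eqP.
exists (wD w L), (wratio w 'X_i L); split.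
- exact: zopen_wD hL.
- exact: Lu.
- exact: Lv.
- exact: regular_wratio (hX i) hL.
- by rewrite /wratio !mevalXU.
Qed.

(** * Birational maps and minimal models *)

(** A birational correspondence between X and Y: dense open sets U and V, and
    total functions f and g that restrict to inverse isomorphisms between U and
    V; the values of f off U and of g off V are irrelevant. *)
Record birational_pair (K : fieldType) (X Y : fspace K) (U : set X) (V : set Y)
    (f : X -> Y) (g : Y -> X) : Prop := BirationalPair {
  bp_openl : zopen X U;
  bp_densel : zdense U;
  bp_openr : zopen Y V;
  bp_denser : zdense V;
  bp_morl : mor_on U f;
  bp_morr : mor_on V g;
  bp_maps : forall x, U x -> V (f x);
  bp_mapsV : forall y, V y -> U (g y);
  bp_can : forall x, U x -> g (f x) = x;
  bp_canV : forall y, V y -> f (g y) = y }.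

Lemma birational_pair_sym (K : fieldType) (X Y : fspace K) (U : set X)
    (V : set Y) (f : X -> Y) (g : Y -> X) :
  birational_pair U V f g -> birational_pair V U g f.
Proof. by case=> *; split. Qed.

Lemma birational_pair_dense (K : fieldType) (X Y : fspace K) (U : set X)
    (V : set Y) (f : X -> Y) (g : Y -> X) (D : set Y) :
  ringed X -> ringed Y -> birational_pair U V f g -> zdense D ->
  zdense (U `&` f @^-1` D).
Proof.
move=> rX rY [oU dU oV dV mf mg UV VU fK gK] dD N oN N0.
have [x [Ux Nx]] := dU N oN N0.
have oM := mor_on_zopen rY oV mg (zopenI rX oU oN).
have [|y [Dy [Vy [Uy Ny]]]] := dD _ oM.
  by exists (f x); split; [exact: UV | rewrite /preimage /= fK].
by exists (g y); split=> //; split=> //; rewrite /preimage /= gK.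
Qed.

Lemma birational_pair_comp (K : fieldType) (X Y Z : fspace K) (U : set X)
    (V U' : set Y) (V' : set Z) (f : X -> Y) (g : Y -> X) (f' : Y -> Z)
    (g' : Z -> Y) :
  ringed X -> ringed Y -> ringed Z ->
  birational_pair U V f g -> birational_pair U' V' f' g' ->
  birational_pair (U `&` f @^-1` U') (V' `&` g' @^-1` V) (f' \o f) (g \o g').
Proof.
move=> rX rY rZ b b'; have [oU dU oV dV mf mg UV VU fK gK] := b.
have [oU' dU' oV' dV' mf' mg' UV' VU' fK' gK'] := b'.
split.
- exact: mor_on_zopen.
- exact: birational_pair_dense b dU'.
- exact: mor_on_zopen.
- exact: birational_pair_dense (birational_pair_sym b') dV.
- have mfr := mor_on_sub rX (@subIsetl _ U (f @^-1` U')) mf.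
  by apply: mor_on_comp mfr mf' _ => // x [].
- have mgr := mor_on_sub rZ (@subIsetl _ V' (g' @^-1` V)) mg'.
  by apply: mor_on_comp mgr mg _ => // x [].
- move=> x [Ux U'x] /=; split; first exact: UV'.
  by rewrite /preimage /= fK' //; exact: UV.
- move=> z [V'z Vz] /=; split; first exact: VU.
  by rewrite /preimage /= gK //; exact: VU'.
- by move=> x [Ux U'x] /=; rewrite fK' // fK.
- by move=> z [V'z Vz] /=; rewrite gK // gK'.
Qed.

(** The isomorphism between open sets of a birational map extends to total
    functions, constant off these sets; this needs a point on either side. *)
Lemma birational_map_pair (K : fieldType) (sigma : P1 K -> P1 K)
    (X Y : fibred K) (x0 : X) (y0 : Y) (U : set X) (V : set Y)
    (h : subspace U -> subspace V) :
  birational_map sigma h -> exists f g, birational_pair U V f g /\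
    forall u : subspace U, f (sval u) = sval (h u).
Proof.
move=> [[oU dU oV dV [mh [k [mk hK kK]]]] hfib].
have tot (A B : fspace K) (P : set A) (a : subspace P -> B) (b0 : B) :
    exists f : A -> B, forall u : subspace P, f (sval u) = a u.
  exists (fun x => match pselect (P x) with
    left Px => a (exist _ x Px) | right _ => b0 end) => -[x Px] /=.
  by case: pselect => // Px'; congr (a (exist _ x _)); exact: Prop_irrelevance.
have [f fE] := tot X Y U (fun u => sval (h u)) y0.
have [g gE] := tot Y X V (fun v => sval (k v)) x0.
exists f, g; split=> //; split=> //.
- rewrite /mor_on (_ : (fun x : subspace U => _) = fun x => sval (h x)).
    exact: morphism_comp mh (@morphism_sval K Y V).
  exact/funext.
- rewrite /mor_on (_ : (fun x : subspace V => _) = fun x => sval (k x)).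
    exact: morphism_comp mk (@morphism_sval K X U).
  exact/funext.
- by move=> x Ux; rewrite (fE (exist _ x Ux)); exact: svalP.
- by move=> y Vy; rewrite (gE (exist _ y Vy)); exact: svalP.
- by move=> x Ux; rewrite (fE (exist _ x Ux)) gE hK.
- by move=> y Vy; rewrite (gE (exist _ y Vy)) fE kK.
Qed.

Lemma birational_pair_map (K : fieldType) (sigma : P1 K -> P1 K)
    (X Y : fibred K) (U : set X) (V : set Y) (f : X -> Y) (g : Y -> X) :
  ringed X -> ringed Y -> birational_pair U V f g ->
  (forall x q, U x -> fib X x q -> fib Y (f x) (sigma q)) ->
  exists2 h : subspace U -> subspace V, birational_map sigma h &
    forall u, sval (h u) = f (sval u).
Proof.
move=> rX rY [oU dU oV dV mf mg UV VU fK gK] ffib.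
pose h (u : subspace U) : subspace V := exist _ (f (sval u)) (UV _ (svalP u)).
pose k (v : subspace V) : subspace U := exist _ (g (sval v)) (VU _ (svalP v)).
exists h => //; split; last by move=> [x Ux] q /=; exact: ffib.
split=> //; split; first exact: (mor_on_lift rX _ mf).
exists k; split; first exact: (mor_on_lift rY _ mg).
- by move=> [x Ux]; apply: eq_exist; exact: fK.
- by move=> [y Vy]; apply: eq_exist; exact: gK.
Qed.

(** Birational equivalence over sigma, in terms of birational pairs. *)
Definition pair_over (K : fieldType) (sigma : P1 K -> P1 K) (X Y : fibred K) :
    Prop :=
  exists (U : set X) (V : set Y) f g, birational_pair U V f g /\
    forall x q, U x -> fib X x q -> fib Y (f x) (sigma q).

Lemma pair_overP (K : fieldType) (sigma : P1 K -> P1 K) (X Y : fibred K) :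
  ringed X -> ringed Y -> X -> Y ->
  birational_over sigma X Y <-> pair_over sigma X Y.
Proof.
move=> rX rY x0 y0; split.
  move=> [U [V [h bh]]]; have [f [g [bfg fE]]] := birational_map_pair x0 y0 bh.
  exists U, V, f, g; split=> // x q Ux.
  by rewrite (fE (exist _ x Ux)); exact: (bh.2 (exist _ x Ux) q).
move=> [U [V [f [g [bfg ffib]]]]].
by have [h bh _] := birational_pair_map rX rY bfg ffib; exists U, V, h.
Qed.

Lemma pair_over_comp (K : fieldType) (sigma tau : P1 K -> P1 K)
    (X Y Z : fibred K) :
  ringed X -> ringed Y -> ringed Z ->
  pair_over sigma X Y -> pair_over tau Y Z -> pair_over (tau \o sigma) X Z.
Proof.
move=> rX rY rZ [U [V [f [g [b bfib]]]]] [U' [V' [f' [g' [b' bfib']]]]].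
have bb := birational_pair_comp rX rY rZ b b'.
do 4![eexists]; split; first exact: bb.
by move=> x q [Ux U'x] /(bfib _ _ Ux); exact: bfib'.
Qed.

(** To invert a birational map over the base, the rational map on the source must
    be everywhere defined and the one on the target single valued. *)
Lemma fib_inverse (K : fieldType) (sigma tau : P1 K -> P1 K) (X Y : fibred K)
    (U : set X) (V : set Y) (f : X -> Y) (g : Y -> X) :
  cancel sigma tau ->
  (forall x, exists q, fib X x q) ->
  (forall y q q', fib Y y q -> fib Y y q' -> q = q') ->
  birational_pair U V f g ->
  (forall x q, U x -> fib X x q -> fib Y (f x) (sigma q)) ->
  forall y q, V y -> fib Y y q -> fib X (g y) (tau q).
Proof.
move=> sK totX funY b bfib y q Vy yq.
have [q' gq'] := totX (g y).
have := bfib _ _ (bp_mapsV b Vy) gq'; rewrite (bp_canV b Vy) => yq'.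
by rewrite (funY _ _ _ yq yq') sK.
Qed.

Lemma pair_over_sym (K : fieldType) (sigma tau : P1 K -> P1 K) (X Y : fibred K) :
  cancel sigma tau ->
  (forall x, exists q, fib X x q) ->
  (forall y q q', fib Y y q -> fib Y y q' -> q = q') ->
  pair_over sigma X Y -> pair_over tau Y X.
Proof.
move=> sK totX funY [U [V [f [g [b bfib]]]]].
exists V, U, g, f; split; first exact: birational_pair_sym.
exact: fib_inverse bfib.
Qed.

Lemma projective_ringed (K : fieldType) (X : fspace K) :
  projective_variety X -> ringed X.
Proof.
move=> [n [A [_ _ iX]]]; apply: isomorphic_ringed iX _.
by apply: subspace_ringed; exact: wproj_ringed.
Qed.

Lemma projective_separated (K : fieldType) (X : fspace K) :
  projective_variety X -> separated X.
Proof.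
move=> [n [A [_ _ iX]]]; apply: isomorphic_separated iX _.
apply: subspace_separated; apply: wproj_separated => i.
by rewrite (tnth_nth 0%N) /= (nth_nseq 0%N n.+1 1%N) ltn_ord.
Qed.

Lemma projective_point (K : fieldType) (X : fspace K) :
  projective_variety X -> exists x : X, True.
Proof.
by move=> [n [A [_ [[a _] _] [f [_ [g _]]]]]]; exists (g a).
Qed.

Lemma P1_separated (K : fieldType) : separated (P1 K).
Proof. by apply: wproj_separated; case=> -[|[]]. Qed.

(** X fibred so that the fibre over q is the former fibre over sigma q; for a
    bijective sigma, the fibration is composed with the inverse of sigma. *)
Definition twist (K : fieldType) (sigma : P1 K -> P1 K) (X : fibred K) :
    fibred K :=
  @Fibred K X (fun x q => fib X x (sigma q)).

Lemma twist_regular (K : fieldType) (sigma tau : P1 K -> P1 K) (X : fibred K) :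
  cancel sigma tau -> cancel tau sigma -> morphism tau ->
  regular_fibred_surface X -> regular_fibred_surface (twist sigma X).
Proof.
move=> sK tK mt [pX nX [pi mpi piE]]; split=> //.
exists (tau \o pi); first exact: morphism_comp mt.
move=> x q; rewrite /= piE; split=> [<-|->]; by rewrite /= ?sK ?tK.
Qed.

(** A birational map between two regular fibred surfaces extends to a morphism
    when the target is a minimal model, even over a nontrivial automorphism of
    the base: twist the source by this automorphism. *)
Lemma minimal_model_extend (K : fieldType) (sigma tau : P1 K -> P1 K)
    (E X Y : fibred K) (U : set Y) (V : set X) (f : Y -> X) (g : X -> Y) :
  cancel sigma tau -> cancel tau sigma -> morphism sigma ->
  minimal_model E X -> regular_fibred_surface Y ->
  birational_pair U V f g ->
  (forall y q, U y -> fib Y y q -> fib X (f y) (sigma q)) ->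
  exists2 h : Y -> X, morphism h & forall y, U y -> h y = f y.
Proof.
move=> sK tK ms [[pX _ _] _ minX] rY b bfib.
have [pY _ _] := rY.
have bfibt (y : twist tau Y) q : U y -> fib (twist tau Y) y q -> fib X (f y) (id q).
  by move=> Uy /(bfib _ _ Uy); rewrite tK.
have [h bh hE] := @birational_pair_map K id (twist tau Y) X U V f g
  (projective_ringed pY) (projective_ringed pX) b bfibt.
have [k mk kE] := minX _ (twist_regular tK sK ms rY) _ _ _ bh.
by exists k => // y Uy; rewrite (kE (exist _ y Uy)) hE.
Qed.

(** A birational map between E and E' over an automorphism sigma of the base induces
    an isomorphism of minimal models over sigma: the birational map between the
    models and its inverse both extend to morphisms, whose composites are the
    identity on dense open sets, hence everywhere. *)
Lemma minimal_model_unique (K : fieldType) (sigma tau : P1 K -> P1 K)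
    (E E' X X' : fibred K) :
  cancel sigma tau -> cancel tau sigma -> morphism sigma -> morphism tau ->
  ringed E -> ringed E' -> E -> E' ->
  (forall y q q', fib E' y q -> fib E' y q' -> q = q') ->
  pair_over sigma E E' -> minimal_model E X -> minimal_model E' X' ->
  isomorphic_over sigma X X'.
Proof.
move=> sK tK ms mt rE rE' e0 e0' funE' bEE' mX mX'.
have [[pX nX [pi mpi piE]] bX _] := mX.
have [[pX' nX' [pi' mpi' piE']] bX' _] := mX'.
have [rX rX'] := (projective_ringed pX, projective_ringed pX').
have [x0 _] := projective_point pX; have [x0' _] := projective_point pX'.
have totX x : exists q, fib X x q by exists (pi x); rewrite piE.
have totX' x : exists q, fib X' x q by exists (pi' x); rewrite piE'.
have funX' x q q' : fib X' x q -> fib X' x q' -> q = q'.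
  by rewrite !piE' => -> ->.
have {}bX := (pair_overP id rX rE x0 e0).1 bX.
have {}bX' := (pair_overP id rX' rE' x0' e0').1 bX'.
have {bX'} bE' : pair_over id E' X' by apply: pair_over_sym bX'.
have := pair_over_comp rX rE rE' bX bEE'.
move=> /(pair_over_comp rX rE' rX')/(_ bE') [U [V [f [g [b bfib]]]]].
have bfib' : forall y q, V y -> fib X' y q -> fib X (g y) (tau q).
  exact: (fib_inverse (sigma := sigma)) bfib.
have rsX : regular_fibred_surface X by case: mX.
have rsX' : regular_fibred_surface X' by case: mX'.
have [h mh hE] := minimal_model_extend sK tK ms mX' rsX b bfib.
have [k mk kE] :=
  minimal_model_extend tK sK mt mX rsX' (birational_pair_sym b) bfib'.
have [dU dV] := (bp_densel b, bp_denser b).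
have hK : cancel h k.
  apply: (morphism_eq (D := U) (f := k \o h) (g := id) rX
    (projective_separated pX)) => //.
  - exact: morphism_comp mh mk.
  - by move=> x Ux /=; rewrite hE // kE ?(bp_can b) //; exact: (bp_maps b).
have kK : cancel k h.
  apply: (morphism_eq (D := V) (f := h \o k) (g := id) rX'
    (projective_separated pX')) => //.
  - exact: morphism_comp mk mh.
  - by move=> x Vx /=; rewrite kE // hE ?(bp_canV b) //; exact: (bp_mapsV b).
exists h; split; first by split=> //; exists k.
have piE2 : forall x, pi' (h x) = sigma (pi x).
  apply: (morphism_eq (D := U) (f := pi' \o h) (g := sigma \o pi) rX
    (@P1_separated K)) => //.
  - exact: morphism_comp mh mpi'.
  - exact: morphism_comp mpi ms.
  - move=> x Ux /=; rewrite hE //; symmetry; apply/piE'.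
    by apply: bfib => //; rewrite piE.
by move=> x q /piE ->; rewrite piE' piE2.
Qed.

(** * Density on surfaces z^2 = Q *)

(** On the curve z^2 = Q(s), every polynomial in functions that are affine in z
    has the form A(s) + B(s) z. *)
Lemma meval_double_cover (K : fieldType) (n : nat) (Q : {poly K})
    (a b : 'I_n -> {poly K}) (f : {mpoly K[n]}) :
  exists A B : {poly K}, forall s z, z ^+ 2 = Q.[s] ->
    f.@[fun i => (a i).[s] + (b i).[s] * z] = A.[s] + B.[s] * z.
Proof.
elim/mpoly_ring_ind: f => [c|i|f g [A [B fE]] [A' [B' gE]]|f g [A [B fE]] [A' [B' gE]]].
- by exists c%:P, 0 => s z _; rewrite mevalC !hornerE.
- by exists (a i), (b i) => s z _; rewrite mevalXU.
- exists (A + A'), (B + B') => s z zQ.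
  by rewrite mevalD fE // gE // !hornerD; ring.
- exists (A * A' + B * B' * Q), (A * B' + A' * B) => s z zQ.
  by rewrite mevalM fE // gE // !hornerD !hornerM -zQ; ring.
Qed.

Lemma closed_sqrt (K : closedFieldType) (c : K) : exists z, z ^+ 2 = c.
Proof.
have [z zE] := @solve_monicpoly K 2 (fun i => if i == 0%N then c else 0) isT.
by exists z; rewrite zE !big_ord_recl big_ord0 /= mul0r expr0 mulr1 !addr0.
Qed.

(** A function that does not vanish at the point (0, z0) of the curve z^2 = Q(s)
    is nonzero at some point where m(s) is nonzero. Otherwise A + B z and its
    conjugate A - B z vanish wherever m does not; thus A = 0 and B^2 Q = 0, and the
    value B(0) z0 at the given point is zero too. *)
Lemma double_cover_dense (K : closedFieldType) (n : nat) (Q m : {poly K})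
    (a b : 'I_n -> {poly K}) (f : {mpoly K[n]}) (z0 : K) :
  (2 : K) != 0 -> m != 0 -> z0 ^+ 2 = Q.[0] ->
  f.@[fun i => (a i).[0] + (b i).[0] * z0] <> 0 ->
  exists s z, [/\ z ^+ 2 = Q.[s], m.[s] <> 0 &
    f.@[fun i => (a i).[s] + (b i).[s] * z] <> 0].
Proof.
move=> two m0 z0Q; have [A [B fE]] := meval_double_cover Q a b f.
rewrite fE // => ne; apply: contrapT => none.
have van s z : m.[s] != 0 -> z ^+ 2 = Q.[s] -> A.[s] + B.[s] * z = 0.
  move=> /eqP ms zQ; apply: contrapT => nz; apply: none; exists s, z; split=> //.
  by rewrite fE.
have A0 : A = 0.
  apply/eqP; apply: contraT => Ane.
  have /closed_nonrootP[s] : m * A != 0 by rewrite mulf_neq0.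
  rewrite rootE hornerM mulf_eq0 negb_or => /andP[ms As].
  have [z zQ] := closed_sqrt Q.[s].
  have e1 := van s z ms zQ; have e2 : A.[s] + B.[s] * - z = 0.
    by apply: van => //; rewrite sqrrN.
  have : 2 * A.[s] = 0 by rewrite -[RHS](addr0 0) -{1}e1 -e2; ring.
  by move/eqP; rewrite mulf_eq0 (negbTE two) (negbTE As).
have BQ : B * Q = 0.
  apply/eqP; apply: contraT => BQne.
  have /closed_nonrootP[s] : m * (B * Q) != 0 by rewrite mulf_neq0.
  rewrite rootE !hornerM !mulf_eq0 !negb_or => /and3P[ms Bs Qs].
  have [z zQ] := closed_sqrt Q.[s].
  have /eqP := van s z ms zQ; rewrite A0 horner0 add0r mulf_eq0 (negbTE Bs) /=.
  by move=> /eqP z00; move: Qs; rewrite -zQ z00 expr0n eqxx.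
apply: ne; rewrite A0 horner0 add0r.
move/eqP: BQ; rewrite mulf_eq0 => /orP[/eqP ->|/eqP Q0].
  by rewrite horner0 mul0r.
move: z0Q; rewrite Q0 horner0 => /eqP; rewrite sqrf_eq0 => /eqP ->.
by rewrite mulr0.
Qed.

(** * Maps between weighted projective spaces *)

(** The map with homogeneous coordinates F; its value is an arbitrary point d
    where they all vanish. *)
Definition wmap (K : fieldType) (n m : nat) (w : n.-tuple nat)
    (w' : m.-tuple nat) (F : m.-tuple {mpoly K[n]}) (d : wpoint K w')
    (p : wproj K w) : wproj K w' :=
  match pselect (exists i,
      tnth [tuple (tnth F i).@[tnth (hrep (p : wpoint K w))] | i < m] i <> 0) with
  | left F0 => wpt w' F0
  | right _ => d
  end.

Lemma hcoord_wmap (K : fieldType) (n m : nat) (w : n.-tuple nat)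
    (w' : m.-tuple nat) (F : m.-tuple {mpoly K[n]}) (d : wpoint K w')
    (p : wpoint K w) v :
  (forall i, whomog w (tnth w' i) (tnth F i)) ->
  hcoord p v -> (exists i, (tnth F i).@[tnth v] <> 0) ->
  hcoord (wmap F d p : wpoint K w') [tuple (tnth F i).@[tnth v] | i < m].
Proof.
move=> hF pv [i Fi]; have [l l0 vE] := hcoord_orbit (hcoord_hrep p) pv.
have FE : [tuple (tnth F i).@[tnth v] | i < m] =
    wscale w' l [tuple (tnth F i).@[tnth (hrep p)] | i < m].
  apply: eq_from_tnth => j; rewrite !tnth_mktuple vE.
  exact: whomog_eval (hF j).
rewrite FE; apply: hcoord_scale => //; rewrite /wmap.
case: pselect => [F0|]; first exact: hcoord_wpt.
case; exists i => Fi0; apply: Fi.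
have := congr1 (fun t => tnth t i) FE.
by move: Fi0; rewrite !tnth_mktuple => ->; rewrite mulr0.
Qed.

Lemma wmap_mor_on (K : fieldType) (n m : nat) (w : n.-tuple nat)
    (w' : m.-tuple nat) (F : m.-tuple {mpoly K[n]}) (d : wpoint K w')
    (A : set (wproj K w)) :
  (forall i, whomog w (tnth w' i) (tnth F i)) ->
  (forall (p : wpoint K w) v, A p -> hcoord p v ->
     exists i, (tnth F i).@[tnth v] <> 0) ->
  mor_on A (wmap F d).
Proof.
move=> hF F0; apply: (wproj_mor_on hF) => p v Ap pv.
by apply: hcoord_wmap => //; exact: F0 Ap pv.
Qed.

(** The point (1 : ... : 1), used as a default value. *)
Definition wpoint1 (K : fieldType) (n : nat) (w : n.+1.-tuple nat) : wpoint K w.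
Proof.
apply: (@wpt K n.+1 w [tuple 1 | _ < n.+1]).
by exists ord0; rewrite tnth_mktuple; exact/eqP/oner_neq0.
Defined.

(** For a condition invariant under scaling, the choice of the coordinates does not
    matter. *)
Lemma wlocusP (K : fieldType) (n : nat) (w : n.-tuple nat)
    (P : set (n.-tuple K)) (p : wpoint K w) v :
  (forall l u, l <> 0 -> P u -> P (wscale w l u)) -> hcoord p v ->
  @wlocus K n w P p <-> P v.
Proof.
move=> Pw pv; split=> [[u pu Pu]|Pv]; last by exists v.
by have [l l0 ->] := hcoord_orbit pu pv; exact: Pw.
Qed.

(** * The involution of the base *)

Definition P1_inv_form (K : fieldType) (c : K) : 2.-tuple {mpoly K[2]} :=
  [tuple 'X_(inord 1); c *: 'X_(inord 0)].

(** The involution (a : b) |-> (b : c a) of the projective line, for c <> 0. *)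
Definition P1_inv (K : fieldType) (c : K) : P1 K -> P1 K :=
  wmap (P1_inv_form c) (wpoint1 K [tuple 1%N; 1%N]).

Lemma P1_inv_homog (K : fieldType) (c : K) i :
  whomog [tuple 1%N; 1%N] (tnth [tuple 1%N; 1%N] i) (tnth (P1_inv_form c) i).
Proof.
have hX (j : 'I_2) : whomog [tuple 1%N; 1%N] 1 ('X_j : {mpoly K[2]}).
  by have := @whomogX K 2 [tuple 1%N; 1%N] j; case: j => -[|[]].
by case: i => -[|[]] // i; [exact: hX | apply: whomogZ; exact: hX].
Qed.

Lemma P1_inv_nonzero (K : fieldType) (c : K) (p : wpoint K [tuple 1%N; 1%N]) v :
  c != 0 -> hcoord p v -> exists i, (tnth (P1_inv_form c) i).@[tnth v] <> 0.
Proof.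
move=> c0 pv; have [[[|[]] // lt vi]] := hcoord_neq0 pv.
- exists (inord 1); rewrite (tnth_nth 0) inordK //= mevalZ mevalXU (tnth_nth 0) inordK //.
  by rewrite mul_ne0; split; [exact/eqP | move: vi; rewrite (tnth_nth 0)].
- exists (inord 0); rewrite (tnth_nth 0) inordK //= mevalXU (tnth_nth 0) inordK //.
  by move: vi; rewrite (tnth_nth 0).
Qed.

Lemma hcoord_P1_inv (K : fieldType) (c : K) (p : P1 K) v :
  c != 0 -> hcoord (p : wpoint K _) v ->
  hcoord (P1_inv c p : wpoint K _) [tuple v`_1; c * v`_0].
Proof.
move=> c0 pv.
have := hcoord_wmap (wpoint1 K [tuple 1%N; 1%N]) (@P1_inv_homog K c) pv
  (P1_inv_nonzero c0 pv).
congr hcoord; apply: eq_from_tnth => i; rewrite tnth_mktuple.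
by case: i => -[|[]] // i; rewrite !(tnth_nth 0) /= ?mevalZ mevalXU (tnth_nth 0) inordK.
Qed.

Lemma P1_inv_morphism (K : fieldType) (c : K) : c != 0 -> morphism (@P1_inv K c).
Proof.
move=> c0; apply: mor_onT; first exact: wproj_ringed.
apply: wmap_mor_on; first exact: P1_inv_homog.
by move=> p v _; exact: P1_inv_nonzero.
Qed.

Lemma P1_invK (K : fieldType) (c : K) : c != 0 -> involutive (@P1_inv K c).
Proof.
move=> c0 p; have pv := hcoord_hrep (p : wpoint K _); set v := hrep _ in pv.
have := hcoord_P1_inv c0 (hcoord_P1_inv c0 pv) => /= qv.
apply: (hcoord_inj qv).
have := hcoord_scale (elimN eqP c0) pv; congr hcoord.
by apply: eq_from_tnth => -[[|[]] // i]; rewrite tnth_mktuple !(tnth_nth 0) /= ?expr1.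
Qed.

(** * The two surfaces *)

(** The equation of S_CD. *)
Definition CD_eq (K : fieldType) (alpha beta gamma delta : K) (x y z : K) : Prop :=
  z ^+ 2 = y ^+ 3 + (- (3 * alpha * x ^+ 4) - gamma * x ^+ 5) * y
      + (x ^+ 5 - 2 * beta * x ^+ 6 + delta * x ^+ 7).

(** The equation of S_t. *)
Definition St_eq (K : fieldType) (t4 t6 t10 t12 t18 : K) (x y z w : K) : Prop :=
  z ^+ 2 = y ^+ 3 + (t4 * x ^+ 4 * w ^+ 4 + t10 * x ^+ 3 * w ^+ 10) * y
        + (x ^+ 7 + t6 * x ^+ 6 * w ^+ 6 + t12 * x ^+ 5 * w ^+ 12
           + t18 * x ^+ 4 * w ^+ 18).

(** The equation is homogeneous of weight 42. *)
Lemma St_eq_scale (K : fieldType) (t4 t6 t10 t12 t18 : K) l (v : 4.-tuple K) :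
  St_eq t4 t6 t10 t12 t18 v`_0 v`_1 v`_2 v`_3 ->
  let u := wscale [tuple 6; 14; 21; 1]%N l v in
  St_eq t4 t6 t10 t12 t18 u`_0 u`_1 u`_2 u`_3.
Proof.
rewrite /St_eq /= !wscale_nth //= => E.
rewrite [LHS](_ : _ = l ^+ 42 * v`_2 ^+ 2); last by ring.
rewrite E; ring.
Qed.

(** The coordinates (x_1, y_1, z_1) of a point of S_CD. *)
Definition CD_affine (K : fieldType) (a b c d : K) (p : S_CD a b c d) :
  3.-tuple K := sval p.

(** The point of the weighted projective space underlying a point of S_t. *)
Definition St_wpoint (K : fieldType) (t4 t6 t10 t12 t18 : K)
  (p : S_t t4 t6 t10 t12 t18) : wpoint K [tuple 6; 14; 21; 1]%N := sval p.

Lemma CD_affineP (K : fieldType) (a b c d : K) (p : S_CD a b c d) :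
  CD_eq a b c d (CD_affine p)`_0 (CD_affine p)`_1 (CD_affine p)`_2.
Proof. exact: (svalP p). Qed.

Lemma St_hcoord (K : fieldType) (t4 t6 t10 t12 t18 : K)
    (p : S_t t4 t6 t10 t12 t18) v : hcoord (St_wpoint p) v ->
  St_eq t4 t6 t10 t12 t18 v`_0 v`_1 v`_2 v`_3.
Proof.
move=> pv; have [u pu uE] := svalP p.
by have [l l0 ->] := hcoord_orbit pu pv; exact: St_eq_scale.
Qed.

(** A point of S_CD is approached along the curve cut out by fixing y_1; x_1 is
    the parameter. *)
Lemma CD_dense (K : closedFieldType) (a b c d : K) : (2 : K) != 0 ->
  @zdense K (S_CD a b c d) [set p | (CD_affine p)`_0 <> 0].
Proof.
move=> two V [W oW ->] [p Wp]; have [f [fp fW]] := oW _ Wp.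
have pE := CD_affineP p; rewrite -/(CD_affine p) [CD_affine p]tuple3E in fp.
move: (CD_affine p)`_0 (CD_affine p)`_1 (CD_affine p)`_2 fp pE => x0 y0 z0 fp pE.
pose x : {poly K} := 'X + x0%:P.
pose Q : {poly K} := (y0 ^+ 3)%:P + (- ((3 * a) *: x ^+ 4) - c *: x ^+ 5) * y0%:P
      + (x ^+ 5 - (2 * b) *: x ^+ 6 + d *: x ^+ 7).
have xE s : x.[s] = s + x0 by rewrite /x !hornerE.
have QE s : Q.[s] = y0 ^+ 3 + (- (3 * a * (s + x0) ^+ 4) - c * (s + x0) ^+ 5) * y0
      + ((s + x0) ^+ 5 - 2 * b * (s + x0) ^+ 6 + d * (s + x0) ^+ 7).
  by rewrite /Q !(hornerD, hornerN, hornerM, hornerZ, hornerC, hornerX, horner_exp).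
pose A := tnth [tuple x; y0%:P; 0]; pose B := tnth [tuple 0; 0; 1 : {poly K}].
have ptE s z : (fun i => (A i).[s] + (B i).[s] * z) = tnth [tuple s + x0; y0; z].
  apply/funext => -[[|[|[|//]]] i]; rewrite /A /B !(tnth_nth 0) /= ?xE ?hornerC;
  by rewrite ?mul0r ?mul1r ?addr0 ?add0r.
have [||| s [z [zQ xs fs]]] := @double_cover_dense K 3 Q x A B f z0 two.
- by apply/eqP => /(congr1 (fun q => q.[1 - x0])); rewrite /= xE subrK horner0; apply/eqP/oner_neq0.
- by rewrite QE add0r.
- by rewrite ptE add0r.
have uS : CD_eq a b c d (s + x0) y0 z by rewrite /CD_eq zQ QE.
exists (exist _ [tuple s + x0; y0; z] uS : S_CD a b c d); split.
  by move: xs; rewrite xE.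
by apply: fW => /=; rewrite -ptE.
Qed.

(** A point of S_t is approached with y fixed and x, w translated by the same
    parameter, along a curve in the affine cone. *)
Lemma St_dense (K : closedFieldType) (t4 t6 t10 t12 t18 : K) : (2 : K) != 0 ->
  @zdense K (S_t t4 t6 t10 t12 t18)
    [set p | wD [tuple 6; 14; 21; 1]%N ('X_(inord 0) * 'X_(inord 3)) (St_wpoint p)].
Proof.
move=> two V [W oW ->] [p Wp]; have [e [f [hf fp fW]]] := oW _ Wp.
have pv := hcoord_hrep (St_wpoint p); have pE := St_hcoord pv.
have {}fp := fp _ pv; rewrite [hrep _]tuple4E in fp.
move: (hrep _)`_0 (hrep _)`_1 (hrep _)`_2 (hrep _)`_3 fp pE => x0 y0 z0 w0 fp pE.
pose x : {poly K} := 'X + x0%:P; pose w : {poly K} := 'X + w0%:P.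
pose Q : {poly K} := (y0 ^+ 3)%:P +
   (t4 *: x ^+ 4 * w ^+ 4 + t10 *: x ^+ 3 * w ^+ 10) * y0%:P
        + (x ^+ 7 + t6 *: x ^+ 6 * w ^+ 6 + t12 *: x ^+ 5 * w ^+ 12
           + t18 *: x ^+ 4 * w ^+ 18).
have xE s : x.[s] = s + x0 by rewrite /x !hornerE.
have wE s : w.[s] = s + w0 by rewrite /w !hornerE.
have QE s z : z ^+ 2 = Q.[s] <-> St_eq t4 t6 t10 t12 t18 (s + x0) y0 z (s + w0).
  by rewrite /Q !(hornerD, hornerN, hornerM, hornerZ, hornerC, hornerX, horner_exp).
pose A := tnth [tuple x; y0%:P; 0; w]; pose B := tnth [tuple 0; 0; 1 : {poly K}; 0].
have ptE s z : (fun i => (A i).[s] + (B i).[s] * z) =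
    tnth [tuple s + x0; y0; z; s + w0].
  apply/funext => -[[|[|[|[|//]]]] i]; rewrite /A /B !(tnth_nth 0) /= ?xE ?wE ?hornerC;
  by rewrite ?mul0r ?mul1r ?addr0 ?add0r.
have mon (c : K) : 'X + c%:P != 0 :> {poly K}.
  apply/eqP => /(congr1 (fun q => q.[1 - c])).
  by rewrite /= hornerD hornerX hornerC subrK horner0; apply/eqP/oner_neq0.
have [||| s [z [zQ ms fs]]] := @double_cover_dense K 4 Q (x * w) A B f z0 two.
- by apply: mulf_neq0; exact: mon.
- by apply: (QE 0 z0).2; rewrite !add0r.
- by rewrite ptE !add0r.
move: ms; rewrite hornerM xE wE => xws; have [xs ws] := (mul_ne0 _ _).1 xws.
have un0 : exists i, tnth [tuple s + x0; y0; z; s + w0] i <> 0.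
  by exists (inord 0); rewrite (tnth_nth 0) inordK.
have uc := hcoord_wpt [tuple 6; 14; 21; 1]%N un0.
have uS : @wlocus K 4 [tuple 6; 14; 21; 1]%N [set v : 4.-tuple K |
     St_eq t4 t6 t10 t12 t18 v`_0 v`_1 v`_2 v`_3] (wpt _ un0).
  by exists [tuple s + x0; y0; z; s + w0] => //; exact: (QE s z).1.
exists (exist _ _ uS : S_t t4 t6 t10 t12 t18); split.
  have h : whomog [tuple 6; 14; 21; 1]%N (6 + 1) ('X_(inord 0) * 'X_(inord 3) : {mpoly K[4]}).
    by apply: whomogM; [have := @whomogX K 4 [tuple 6; 14; 21; 1]%N (inord 0) |
      have := @whomogX K 4 [tuple 6; 14; 21; 1]%N (inord 3)];
      rewrite (tnth_nth 0%N) inordK.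
  apply/(wDE h uc); rewrite mevalM !mevalXU !(tnth_nth 0) !inordK //.
by apply: (fW _ _ uc); rewrite -ptE.
Qed.



(** * The birational map between the two surfaces *)

(** With (alpha, beta, gamma, delta) = (a, b, c, d), the vector
    (-3 alpha, -2 beta, -gamma, delta) is (t4, t6, t10, t12) scaled by mu in the
    weights 4, 6, 10, 12. *)
Definition param_match (K : fieldType) (mu a b c d t4 t6 t10 t12 : K) : Prop :=
  [/\ 3 * a = - (mu ^+ 4 * t4), 2 * b = - (mu ^+ 6 * t6),
      c = - (mu ^+ 10 * t10) & d = mu ^+ 12 * t12].

(** Division by x_1^12 turns the equation of S_CD into that of S_t on the chart
    w = mu. At x_1 = 0 the inverse is 0 by convention, and both sides of the
    equation vanish. *)
Lemma CD_to_St_eq (K : fieldType) (mu a b c d t4 t6 t10 t12 x y z : K) :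
  param_match mu a b c d t4 t6 t10 t12 -> CD_eq a b c d x y z ->
  St_eq t4 t6 t10 t12 0 x^-1 (y / x ^+ 4) (z / x ^+ 6) mu.
Proof.
move=> [h4 h6 -> ->]; rewrite /CD_eq h4 h6 => E; rewrite /St_eq.
have [->|x0] := eqVneq x 0.
  by rewrite invr0 !expr0n /= invr0 ?(mulr0, mul0r, addr0, expr0n).
rewrite [LHS](_ : _ = z ^+ 2 / x ^+ 12); last by field.
by rewrite E; field.
Qed.

(** The inverse substitution; at x = 0 the three coordinates are 0 by
    convention. *)
Lemma St_to_CD_eq (K : fieldType) (mu a b c d t4 t6 t10 t12 x y z w : K) :
  mu != 0 ->
  param_match mu a b c d t4 t6 t10 t12 -> St_eq t4 t6 t10 t12 0 x y z w ->
  CD_eq a b c d (w ^+ 6 / (mu ^+ 6 * x)) (y * w ^+ 10 / (mu ^+ 10 * x ^+ 4))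
    (z * w ^+ 15 / (mu ^+ 15 * x ^+ 6)).
Proof.
move=> mu0 [h4 h6 -> ->]; rewrite /CD_eq h4 h6 /St_eq => E.
have [->|x0] := eqVneq x 0.
  by rewrite !expr0n /= ?(mulr0, invr0, mul0r, addr0, oppr0, expr0n).
rewrite [LHS](_ : _ = z ^+ 2 * w ^+ 30 / (mu ^+ 30 * x ^+ 12)); last first.
  by field; rewrite mu0 x0.
by rewrite E; field; rewrite mu0 x0.
Qed.

(** The map (x_1, y_1, z_1) |-> (1 / x_1 : y_1 / x_1^4 : z_1 / x_1^6 : mu). *)
Definition CD_coord (K : fieldType) (mu : K) (v : 3.-tuple K) : 4.-tuple K :=
  [tuple (v`_0)^-1; v`_1 / v`_0 ^+ 4; v`_2 / v`_0 ^+ 6; mu].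

Lemma CD_coord_neq0 (K : fieldType) (mu : K) (v : 3.-tuple K) :
  mu != 0 -> exists i, tnth (CD_coord mu v) i <> 0.
Proof. by exists (inord 3); rewrite (tnth_nth 0) inordK //; exact/eqP. Qed.

Lemma CD_to_St_locus (K : fieldType) (mu a b c d t4 t6 t10 t12 : K)
    (mu0 : mu != 0) (p : S_CD a b c d) :
  param_match mu a b c d t4 t6 t10 t12 ->
  @wlocus K 4 [tuple 6; 14; 21; 1]%N [set v : 4.-tuple K |
     St_eq t4 t6 t10 t12 0 v`_0 v`_1 v`_2 v`_3]
    (wpt _ (CD_coord_neq0 (CD_affine p) mu0)).
Proof.
move=> h; exists (CD_coord mu (CD_affine p)); first exact: hcoord_wpt.
exact: CD_to_St_eq h (CD_affineP p).
Qed.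

(** The total function from S_CD to S_t; it is a morphism where x_1 <> 0. *)
Definition CD_to_St (K : fieldType) (mu a b c d t4 t6 t10 t12 : K)
    (mu0 : mu != 0) (h : param_match mu a b c d t4 t6 t10 t12)
    (p : S_CD a b c d) : S_t t4 t6 t10 t12 0 :=
  exist _ _ (CD_to_St_locus mu0 p h).

Lemma hcoord_CD_to_St (K : fieldType) (mu a b c d t4 t6 t10 t12 : K)
    (mu0 : mu != 0) (h : param_match mu a b c d t4 t6 t10 t12)
    (p : S_CD a b c d) :
  hcoord (St_wpoint (CD_to_St mu0 h p)) (CD_coord mu (CD_affine p)).
Proof. exact: hcoord_wpt. Qed.

(** Numerators and denominators of (x_1, y_1, z_1) as forms of degree 6, 24 and
    36 in (x : y : z : w). *)
Definition St_num (K : fieldType) (mu : K) : 3.-tuple {mpoly K[4]} :=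
  [tuple mu^-1 ^+ 6 *: 'X_(inord 3) ^+ 6;
         mu^-1 ^+ 10 *: ('X_(inord 1) * 'X_(inord 3) ^+ 10);
         mu^-1 ^+ 15 *: ('X_(inord 2) * 'X_(inord 3) ^+ 15)].

Definition St_den (K : fieldType) : 3.-tuple {mpoly K[4]} :=
  [tuple 'X_(inord 0); 'X_(inord 0) ^+ 4; 'X_(inord 0) ^+ 6].

(** The inverse of CD_coord, invariant under scaling of (x : y : z : w). *)
Definition St_coord (K : fieldType) (mu : K) (v : 4.-tuple K) : 3.-tuple K :=
  [tuple v`_3 ^+ 6 / (mu ^+ 6 * v`_0);
         v`_1 * v`_3 ^+ 10 / (mu ^+ 10 * v`_0 ^+ 4);
         v`_2 * v`_3 ^+ 15 / (mu ^+ 15 * v`_0 ^+ 6)].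

Lemma St_homogX (K : fieldType) k : (k < 4)%N ->
  whomog [tuple 6; 14; 21; 1]%N (nth 0 [:: 6; 14; 21; 1] k)%N
    ('X_(inord k) : {mpoly K[4]}).
Proof.
move=> k4; have := @whomogX K 4 [tuple 6; 14; 21; 1]%N (inord k).
by rewrite (tnth_nth 0%N) inordK.
Qed.

Lemma St_homog (K : fieldType) (mu : K) (i : 'I_3) :
  let e := nth 0%N [:: 6; 24; 36]%N i in
  whomog [tuple 6; 14; 21; 1]%N e (tnth (St_num mu) i) /\
  whomog [tuple 6; 14; 21; 1]%N e (tnth (St_den K) i).
Proof.
have hX := @St_homogX K.
case: i => -[|[|[|//]]] i3; rewrite !(tnth_nth 0) /=; split.
- by apply: whomogZ; exact: (whomogXn (k := 6) (hX 3 isT)).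
- exact: (hX 0%N).
- by apply: whomogZ; exact: (whomogM (hX 1%N isT) (whomogXn (k := 10) (hX 3 isT))).
- exact: (whomogXn (k := 4) (hX 0%N isT)).
- by apply: whomogZ; exact: (whomogM (hX 2 isT) (whomogXn (k := 15) (hX 3 isT))).
- exact: (whomogXn (k := 6) (hX 0%N isT)).
Qed.

Lemma St_coord_ratio (K : fieldType) (mu : K) (p : wpoint K [tuple 6; 14; 21; 1]%N)
    v i : hcoord p v ->
  tnth (St_coord mu v) i =
  wratio [tuple 6; 14; 21; 1]%N (tnth (St_num mu) i) (tnth (St_den K) i) p.
Proof.
move=> pv; have [hn hd] := St_homog mu i; rewrite (wratioE hn hd pv).
case: i {hn hd} => -[|[|[|//]]] i3; rewrite !(tnth_nth 0) /=;
  rewrite ?mevalZ ?mevalM ?mevalXn ?mevalXU !(tnth_nth 0) !inordK //;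
  by rewrite exprVn invfM; ring.
Qed.

Lemma St_to_CD_locus (K : fieldType) (mu a b c d t4 t6 t10 t12 : K)
    (mu0 : mu != 0) (p : S_t t4 t6 t10 t12 0) :
  param_match mu a b c d t4 t6 t10 t12 ->
  let v := St_coord mu (hrep (St_wpoint p)) in CD_eq a b c d v`_0 v`_1 v`_2.
Proof.
by move=> h; exact: (St_to_CD_eq mu0 h (St_hcoord (hcoord_hrep (St_wpoint p)))).
Qed.

(** The total function from S_t to S_CD; it is a morphism where x w <> 0. *)
Definition St_to_CD (K : fieldType) (mu a b c d t4 t6 t10 t12 : K)
    (mu0 : mu != 0) (h : param_match mu a b c d t4 t6 t10 t12)
    (p : S_t t4 t6 t10 t12 0) : S_CD a b c d :=
  exist _ (St_coord mu (hrep (St_wpoint p))) (St_to_CD_locus mu0 p h).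

Lemma St_to_CDE (K : fieldType) (mu a b c d t4 t6 t10 t12 : K)
    (mu0 : mu != 0) (h : param_match mu a b c d t4 t6 t10 t12)
    (p : S_t t4 t6 t10 t12 0) v : hcoord (St_wpoint p) v ->
  CD_affine (St_to_CD mu0 h p) = St_coord mu v.
Proof.
move=> pv; apply: eq_from_tnth => i.
by rewrite (St_coord_ratio mu i pv) (St_coord_ratio mu i (hcoord_hrep _)).
Qed.

(** The open set x_1 <> 0 of S_CD. *)
Definition CD_open (K : fieldType) (a b c d : K) : set (S_CD a b c d) :=
  [set p | (CD_affine p)`_0 <> 0].

(** The open set x w <> 0 of S_t. *)
Definition St_open (K : fieldType) (t4 t6 t10 t12 t18 : K) :
    set (S_t t4 t6 t10 t12 t18) :=
  [set p | wD [tuple 6; 14; 21; 1]%N ('X_(inord 0) * 'X_(inord 3)) (St_wpoint p)].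

Lemma St_openP (K : fieldType) (t4 t6 t10 t12 t18 : K)
    (p : S_t t4 t6 t10 t12 t18) v : hcoord (St_wpoint p) v ->
  @St_open K t4 t6 t10 t12 t18 p <-> v`_0 <> 0 /\ v`_3 <> 0.
Proof.
move=> pv; have hX := @St_homogX K.
rewrite /St_open /= (wDE (whomogM (hX 0%N isT) (hX 3 isT)) pv).
by rewrite mevalM !mevalXU !(tnth_nth 0) !inordK // mul_ne0.
Qed.

Lemma CD_ringed (K : fieldType) (a b c d : K) : ringed (S_CD a b c d).
Proof. by apply: subspace_ringed; exact: affine_ringed. Qed.

Lemma St_ringed (K : fieldType) (t4 t6 t10 t12 t18 : K) :
  ringed (S_t t4 t6 t10 t12 t18).
Proof. by apply: subspace_ringed; exact: wproj_ringed. Qed.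

Lemma CD_to_St_mor (K : fieldType) (mu a b c d t4 t6 t10 t12 : K)
    (mu0 : mu != 0) (h : param_match mu a b c d t4 t6 t10 t12) :
  mor_on (@CD_open K a b c d) (CD_to_St mu0 h).
Proof.
have rS : ringed (subspace (@CD_open K a b c d)).
  by apply: subspace_ringed; exact: CD_ringed.
apply: (morphism_lift rS).
(* CD_coord mu scaled by x_1, which clears the denominators. *)
pose F : 4.-tuple {mpoly K[3]} := [tuple 'X_(inord 0) ^+ 5;
  'X_(inord 1) * 'X_(inord 0) ^+ 10; 'X_(inord 2) * 'X_(inord 0) ^+ 15;
  mu *: 'X_(inord 0)].
pose co (x : subspace (@CD_open K a b c d)) := CD_affine (sval x).
have mco : morphism (co : _ -> affine_space K 3).
  exact: morphism_comp (@morphism_sval _ _ _) (@morphism_sval _ _ _).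
apply: (@morphism_wproj K _ 4 _ (fun i x => (tnth F i).@[tnth (co x)]) _ rS).
  move=> i; apply: (regular_pull (V := setT) mco _ (regular_mpoly (tnth F i))) => //.
  exact: zopenT (affine_ringed K 3).
move=> x; have /= x0 := svalP x; rewrite -/(co x) in x0.
have := hcoord_scale x0 (hcoord_CD_to_St mu0 h (sval x)).
congr hcoord; apply: eq_from_tnth => i; rewrite tnth_wscale tnth_mktuple.
move/eqP: x0; rewrite -/(co x); move: (co x) => v v0.
case: i => -[|[|[|[|//]]]] i3; rewrite !(tnth_nth 0) /=;
  rewrite ?mevalZ ?mevalM ?mevalXn ?mevalXU ?(tnth_nth 0) ?inordK //;
  by field.
Qed.

Lemma St_to_CD_mor (K : fieldType) (mu a b c d t4 t6 t10 t12 : K)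
    (mu0 : mu != 0) (h : param_match mu a b c d t4 t6 t10 t12) :
  mor_on (@St_open K t4 t6 t10 t12 0) (St_to_CD mu0 h).
Proof.
have rS : ringed (subspace (@St_open K t4 t6 t10 t12 0)).
  by apply: subspace_ringed; exact: St_ringed.
apply: (morphism_lift rS); apply: (morphism_affine rS) => i.
have [hn hd] := St_homog mu i.
pose co (x : subspace (@St_open K t4 t6 t10 t12 0)) := St_wpoint (sval x).
have mco : morphism (co : _ -> wproj K _).
  exact: morphism_comp (@morphism_sval _ _ _) (@morphism_sval _ _ _).
have := regular_pull mco (zopen_wD hd) (regular_wratio hn hd).
rewrite (_ : _ \o co = fun x => tnth (sval (St_to_CD mu0 h (sval x))) i).
  apply=> x; have [x0 _] := (St_openP (hcoord_hrep _)).1 (svalP x).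
  apply/(wDE hd (hcoord_hrep (co x))).
  case: i {hn hd} => -[|[|[|//]]] i3; rewrite (tnth_nth 0) /=;
    rewrite ?mevalXn mevalXU (tnth_nth 0) inordK //;
    by apply/eqP; rewrite ?expf_neq0 //; exact/eqP.
by apply/funext => x /=; rewrite (St_coord_ratio mu i (hcoord_hrep _)).
Qed.

Lemma CD_St_birational (K : closedFieldType) (mu a b c d t4 t6 t10 t12 : K)
    (mu0 : mu != 0) (h : param_match mu a b c d t4 t6 t10 t12) :
  (2 : K) != 0 ->
  birational_pair (@CD_open K a b c d) (@St_open K t4 t6 t10 t12 0)
    (CD_to_St mu0 h) (St_to_CD mu0 h).
Proof.
move=> two; have mu0P := elimN eqP mu0.
have X0 (v : 3.-tuple K) : v`_0 <> 0 -> (CD_coord mu v)`_0 <> 0.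
  by move=> /eqP v0; apply/eqP; rewrite invr_neq0.
split.
- exists [set v | ('X_(inord 0) : {mpoly K[3]}).@[tnth (v : 3.-tuple K)] <> 0].
    exact: (zopen_neq0T (affine_ringed K 3) (regular_mpoly _)).
  by apply/seteqP; split=> p /=; rewrite /CD_open /= mevalXU (tnth_nth 0) inordK.
- exact: CD_dense.
- have hX := @St_homogX K.
  by exists (wD [tuple 6; 14; 21; 1]%N ('X_(inord 0) * 'X_(inord 3))) => //;
    exact: (zopen_wD (whomogM (hX 0%N isT) (hX 3 isT))).
- exact: St_dense.
- exact: CD_to_St_mor.
- exact: St_to_CD_mor.
- move=> p p0; apply/(St_openP (hcoord_CD_to_St mu0 h p)); split=> //.
  exact: X0.
- move=> p po; have pv := hcoord_hrep (St_wpoint p).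
  have [/eqP x0 /eqP w0] := (St_openP pv).1 po.
  rewrite /CD_open /mkset (St_to_CDE mu0 h pv) /=; apply/eqP.
  by rewrite mulf_neq0 ?invr_neq0 ?mulf_neq0 ?expf_neq0.
- move=> p /eqP p0; suff E : CD_affine (St_to_CD mu0 h (CD_to_St mu0 h p)) = CD_affine p.
    by case: (St_to_CD _ _ _) E => q qP; case: p {p0} => r rP; exact: eq_exist.
  rewrite (St_to_CDE mu0 h (hcoord_CD_to_St mu0 h p)) [RHS]tuple3E.
  rewrite -/(CD_affine p) in p0.
  apply: eq_from_tnth => -[[|[|[|//]]] i3]; rewrite !(tnth_nth 0) /=;
    by field; rewrite mu0 p0.
- move=> p po; have pv := hcoord_hrep (St_wpoint p).
  have [/eqP x0 /eqP w0] := (St_openP pv).1 po.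
  suff E : St_wpoint (CD_to_St mu0 h (St_to_CD mu0 h p)) = St_wpoint p.
    by case: (CD_to_St _ _ _) E => q qP; case: p {po pv x0 w0} => r rP; exact: eq_exist.
  apply: (hcoord_inj (hcoord_CD_to_St mu0 h _)).
  (* Scaling the coordinates of p to w = mu gives those of its image under the two
     maps in turn. *)
  have muw : mu / (hrep (St_wpoint p))`_3 <> 0.
    by apply/eqP; rewrite mulf_neq0 ?invr_neq0.
  have := hcoord_scale muw pv; congr hcoord.
  rewrite (St_to_CDE mu0 h pv); move: (hrep _) x0 w0 => v x0 w0.
  apply: eq_from_tnth => -[[|[|[|[|//]]]] i3]; rewrite tnth_wscale (tnth_nth 0) /=;
    by field; rewrite ?mu0 ?x0 ?w0.
Qed.

(** The map covers (x_1 : 1) |-> (1 / x_1 : mu^6). *)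
Lemma CD_to_St_fib (K : fieldType) (mu a b c d t4 t6 t10 t12 : K)
    (mu0 : mu != 0) (h : param_match mu a b c d t4 t6 t10 t12)
    (p : S_CD a b c d) q :
  CD_open p -> fib (S_CD a b c d) p q ->
  fib (S_t t4 t6 t10 t12 0) (CD_to_St mu0 h p) (P1_inv (mu ^+ 6) q).
Proof.
move=> /eqP p0 pq; exists (CD_coord mu (CD_affine p)).
  exact: (hcoord_CD_to_St mu0 h p).
have m6 : mu ^+ 6 != 0 by rewrite expf_neq0.
have x0 : ((CD_affine p)`_0)^-1 <> 0 by apply/eqP; rewrite invr_neq0.
apply: (hcoord_eq (hcoord_scale x0 (hcoord_P1_inv m6 pq))).
rewrite -/(CD_affine p); move: (CD_affine p) p0 => v v0.
by apply: eq_from_tnth => -[[|[|//]] i]; rewrite tnth_wscale (tnth_nth 0) /=; field.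
Qed.

Lemma St_fib_fun (K : fieldType) (t4 t6 t10 t12 t18 : K)
    (p : S_t t4 t6 t10 t12 t18) q q' :
  fib (S_t t4 t6 t10 t12 t18) p q -> fib (S_t t4 t6 t10 t12 t18) p q' -> q = q'.
Proof.
move=> [v pv qv] [u pu qu]; have [l l0 uE] := hcoord_orbit pv pu.
suff qu' : hcoord (q : wpoint K _) [tuple u`_0; u`_3 ^+ 6].
  exact: (hcoord_inj qu' qu).
have l6 : l ^+ 6 <> 0 by apply/eqP; rewrite expf_neq0 //; exact/eqP.
apply: (hcoord_eq (hcoord_scale l6 qv)); rewrite uE.
by apply: eq_from_tnth => -[[|[|//]] i]; rewrite tnth_wscale (tnth_nth 0) /=
  !wscale_nth //= expr1 ?expr1 // exprMn.
Qed.

(** Both surfaces are fibred over the line, by x_1 and by x / w^6, and the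
    birational map inverts this parameter up to the constant mu^6. *)
Lemma CD_St_isomorphic (K : closedFieldType) (mu a b c d t4 t6 t10 t12 : K) :
  (2 : K) != 0 -> mu != 0 -> param_match mu a b c d t4 t6 t10 t12 ->
  elliptic_isomorphic (S_CD a b c d) (S_t t4 t6 t10 t12 0).
Proof.
move=> two mu0 h; have m6 : mu ^+ 6 != 0 by rewrite expf_neq0.
have o3 : CD_eq a b c d 0 0 0 by rewrite /CD_eq !expr0n /= ?(mulr0, subr0, addr0).
pose e0 : S_CD a b c d := exist _ [tuple 0; 0; 0] o3.
have [mP PK] := (P1_inv_morphism m6, P1_invK m6).
have bP : pair_over (P1_inv (mu ^+ 6)) (S_CD a b c d) (S_t t4 t6 t10 t12 0).
  exists (@CD_open K a b c d), (@St_open K t4 t6 t10 t12 0),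
    (CD_to_St mu0 h), (St_to_CD mu0 h); split; first exact: CD_St_birational.
  by move=> p q; exact: CD_to_St_fib.
exists (P1_inv (mu ^+ 6)); split.
- by split=> //; exists (P1_inv (mu ^+ 6)).
- apply/pair_overP => //; [exact: CD_ringed | exact: St_ringed |].
  exact: CD_to_St mu0 h e0.
- move=> X X'.
  apply: (minimal_model_unique PK PK mP mP (CD_ringed _ _ _ _)
    (St_ringed _ _ _ _ _) e0 (CD_to_St mu0 h e0)) => //.
  by move=> y q q'; exact: St_fib_fun.
Qed.

(** * The parameter spaces *)

(** The map (alpha : beta : gamma : delta) |->
    (-3 alpha : -2 beta : -gamma : delta : 0), by its forms. *)
Definition param_form (K : fieldType) : 5.-tuple {mpoly K[4]} :=
  [tuple (- 3) *: 'X_(inord 0); (- 2) *: 'X_(inord 1); (- 1) *: 'X_(inord 2);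
         'X_(inord 3); 0].

(** The forms of its inverse, which have no common zero where t18 = 0. *)
Definition param_inv_form (K : fieldType) : 4.-tuple {mpoly K[5]} :=
  [tuple (- 3)^-1 *: 'X_(inord 0); (- 2)^-1 *: 'X_(inord 1);
         (- 1) *: 'X_(inord 2); 'X_(inord 3)].

(** The values of these forms. *)
Definition param_coord (K : fieldType) (v : 4.-tuple K) : 5.-tuple K :=
  [tuple - 3 * v`_0; - 2 * v`_1; - v`_2; v`_3; 0].

Definition param_inv_coord (K : fieldType) (v : 5.-tuple K) : 4.-tuple K :=
  [tuple v`_0 / - 3; v`_1 / - 2; - v`_2; v`_3].

Lemma param_form_eval (K : fieldType) (v : 4.-tuple K) :
  [tuple (tnth (param_form K) i).@[tnth v] | i < 5] = param_coord v.
Proof.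
apply: eq_from_tnth => -[[|[|[|[|[|//]]]]] i]; rewrite tnth_mktuple !(tnth_nth 0) /=;
  by rewrite ?mevalZ ?mevalXU ?(tnth_nth 0) ?inordK ?meval0 ?mulN1r.
Qed.

Lemma param_inv_form_eval (K : fieldType) (v : 5.-tuple K) :
  [tuple (tnth (param_inv_form K) i).@[tnth v] | i < 4] = param_inv_coord v.
Proof.
apply: eq_from_tnth => -[[|[|[|[|//]]]] i]; rewrite tnth_mktuple !(tnth_nth 0) /=;
  by rewrite ?mevalZ ?mevalXU ?(tnth_nth 0) ?inordK ?mulN1r // mulrC.
Qed.

Lemma param_form_homog (K : fieldType) i :
  whomog [tuple 4; 6; 10; 12]%N (tnth [tuple 4; 6; 10; 12; 18]%N i)
    (tnth (param_form K) i).
Proof.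
have hX k : (k < 4)%N -> whomog [tuple 4; 6; 10; 12]%N
    (nth 0 [:: 4; 6; 10; 12] k)%N ('X_(inord k) : {mpoly K[4]}).
  move=> k4; have := @whomogX K 4 [tuple 4; 6; 10; 12]%N (inord k).
  by rewrite (tnth_nth 0%N) inordK.
case: i => -[|[|[|[|[|//]]]]] i; rewrite (tnth_nth 0%N) (tnth_nth 0) /=.
- by apply: whomogZ; exact: (hX 0%N).
- by apply: whomogZ; exact: (hX 1%N).
- by apply: whomogZ; exact: (hX 2).
- exact: (hX 3).
- exact: whomog0.
Qed.

Lemma param_inv_form_homog (K : fieldType) i :
  whomog [tuple 4; 6; 10; 12; 18]%N (tnth [tuple 4; 6; 10; 12]%N i)
    (tnth (param_inv_form K) i).
Proof.
have hX k : (k < 5)%N -> whomog [tuple 4; 6; 10; 12; 18]%N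
    (nth 0 [:: 4; 6; 10; 12; 18] k)%N ('X_(inord k) : {mpoly K[5]}).
  move=> k4; have := @whomogX K 5 [tuple 4; 6; 10; 12; 18]%N (inord k).
  by rewrite (tnth_nth 0%N) inordK.
case: i => -[|[|[|[|//]]]] i; rewrite (tnth_nth 0%N) (tnth_nth 0) /=.
- by apply: whomogZ; exact: (hX 0%N).
- by apply: whomogZ; exact: (hX 1%N).
- by apply: whomogZ; exact: (hX 2).
- exact: (hX 3).
Qed.

Lemma T0P (K : fieldType) (p : wpoint K [tuple 4; 6; 10; 12]%N) v :
  hcoord p v -> @T0 K p <-> ~ (v`_2 = 0 /\ v`_3 = 0).
Proof.
move=> pv; apply: (wlocusP (P := [set v : 4.-tuple K | ~ (v`_2 = 0 /\ v`_3 = 0)])) pv.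
move=> l u l0 u0 /=; rewrite !wscale_nth //=.
by move=> [/(expf_mul_eq0 l0) e1 /(expf_mul_eq0 l0) e2]; apply: u0.
Qed.

Lemma T_t18_eq0P (K : fieldType) (p : wpoint K [tuple 4; 6; 10; 12; 18]%N) v :
  hcoord p v -> @T_t18_eq0 K p <-> ~ (v`_2 = 0 /\ v`_3 = 0) /\ v`_4 = 0.
Proof.
move=> pv; rewrite /T_t18_eq0 /setI /mkset.
have -> : wlocus [set v : 5.-tuple K | v`_4 = 0] p <-> v`_4 = 0.
  apply: (wlocusP (P := [set v : 5.-tuple K | v`_4 = 0])) pv => l u _ /= u4.
  by rewrite wscale_nth //= u4 mulr0.
have -> : @T K p <-> ~ [/\ v`_2 = 0, v`_3 = 0 & v`_4 = 0].
  apply: (wlocusP (P := [set v : 5.-tuple K | ~ [/\ v`_2 = 0, v`_3 = 0 & v`_4 = 0]])) pv.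
  move=> l u l0 u0 /=; rewrite !wscale_nth //=.
  move=> [/(expf_mul_eq0 l0) e1 /(expf_mul_eq0 l0) e2 /(expf_mul_eq0 l0) e3].
  exact: u0.
by split=> -[ne v4]; split=> // e; apply: ne; case: e.
Qed.

(** The map of parameter spaces, total on the weighted projective space. *)
Definition param_map (K : fieldType) :=
  @wmap K 4 5 [tuple 4; 6; 10; 12]%N [tuple 4; 6; 10; 12; 18]%N
    (param_form K) (wpoint1 K _).

(** Its inverse; off the locus of T where t18 = 0, it may take a default value. *)
Definition param_inv (K : fieldType) :=
  @wmap K 5 4 [tuple 4; 6; 10; 12; 18]%N [tuple 4; 6; 10; 12]%N
    (param_inv_form K) (wpoint1 K _).

Lemma param_form_neq0 (K : fieldType) (p : wpoint K [tuple 4; 6; 10; 12]%N) v :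
  @T0 K p -> hcoord p v -> exists i, (tnth (param_form K) i).@[tnth v] <> 0.
Proof.
move=> Tp pv; apply: contrapT => /forallNP E; apply: (T0P pv).1 => //.
have F i : (param_coord v)`_i = 0.
  have [i5|i5] := ltnP i 5; last by rewrite nth_default.
  have /contrapT := E (Ordinal i5).
  by rewrite -param_form_eval -(tnth_nth 0 _ (Ordinal i5)) tnth_mktuple.
by split; [have /eqP := F 2; rewrite oppr_eq0 => /eqP | exact: F 3].
Qed.

Lemma param_inv_form_neq0 (K : fieldType)
    (p : wpoint K [tuple 4; 6; 10; 12; 18]%N) v :
  @T_t18_eq0 K p -> hcoord p v ->
  exists i, (tnth (param_inv_form K) i).@[tnth v] <> 0.
Proof.
move=> Tp pv; apply: contrapT => /forallNP E; apply: ((T_t18_eq0P pv).1 Tp).1.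
have F i : (param_inv_coord v)`_i = 0.
  have [i4|i4] := ltnP i 4; last by rewrite nth_default.
  have /contrapT := E (Ordinal i4).
  by rewrite -param_inv_form_eval -(tnth_nth 0 _ (Ordinal i4)) tnth_mktuple.
by split; [have /eqP := F 2; rewrite oppr_eq0 => /eqP | exact: F 3].
Qed.

Lemma hcoord_param (K : fieldType) (p : wpoint K [tuple 4; 6; 10; 12]%N) v :
  @T0 K p -> hcoord p v -> hcoord (param_map p : wpoint K _) (param_coord v).
Proof.
move=> Tp pv; rewrite -param_form_eval.
apply: hcoord_wmap => //; first exact: param_form_homog.
exact: param_form_neq0 Tp pv.
Qed.

Lemma hcoord_param_inv (K : fieldType)
    (p : wpoint K [tuple 4; 6; 10; 12; 18]%N) v :
  @T_t18_eq0 K p -> hcoord p v ->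
  hcoord (param_inv p : wpoint K _) (param_inv_coord v).
Proof.
move=> Tp pv; rewrite -param_inv_form_eval.
apply: hcoord_wmap => //; first exact: param_inv_form_homog.
exact: param_inv_form_neq0 Tp pv.
Qed.

Lemma param_map_T (K : fieldType) (p : wproj K [tuple 4; 6; 10; 12]%N) :
  @T0 K p -> @T_t18_eq0 K (param_map p).
Proof.
move=> Tp; have pv := hcoord_hrep (p : wpoint K _).
apply/(T_t18_eq0P (hcoord_param Tp pv)); split=> //= -[/eqP + v3].
by rewrite oppr_eq0 => /eqP v2; apply: (T0P pv).1.
Qed.

Lemma param_inv_T (K : fieldType) (p : wproj K [tuple 4; 6; 10; 12; 18]%N) :
  @T_t18_eq0 K p -> @T0 K (param_inv p).
Proof.
move=> Tp; have pv := hcoord_hrep (p : wpoint K _).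
apply/(T0P (hcoord_param_inv Tp pv)) => /= -[/eqP + v3].
by rewrite oppr_eq0 => /eqP v2; apply: ((T_t18_eq0P pv).1 Tp).1.
Qed.

(** The identification of T0 with the locus t18 = 0 in T. *)
Definition param_iso (K : fieldType) (p : subspace (@T0 K)) :
    subspace (@T_t18_eq0 K) :=
  exist _ (param_map (sval p)) (param_map_T (svalP p)).

Lemma param_isomorphism (K : fieldType) : (2 : K) != 0 -> (3 : K) != 0 ->
  isomorphism (@param_iso K).
Proof.
move=> two three; split.
  apply: (@mor_on_lift K _ _ _ _ (@param_map K)) => //; first exact: wproj_ringed.
  by apply: wmap_mor_on; [exact: param_form_homog | exact: param_form_neq0].
exists (fun p => exist _ (param_inv (sval p)) (param_inv_T (svalP p))); split.
- apply: (@mor_on_lift K _ _ _ _ (@param_inv K)) => //; first exact: wproj_ringed.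
  by apply: wmap_mor_on; [exact: param_inv_form_homog | exact: param_inv_form_neq0].
- move=> [p Tp]; apply: eq_exist => /=; have pv := hcoord_hrep (p : wpoint K _).
  apply: hcoord_inj (hcoord_param_inv (param_map_T Tp) (hcoord_param Tp pv)) _.
  apply: (hcoord_eq pv); rewrite [LHS]tuple4E; move: (hrep _) => v.
  by apply: eq_from_tnth => -[[|[|[|[|//]]]] i]; rewrite !(tnth_nth 0) /=;
    field; rewrite ?oppr_eq0.
- move=> [p Tp]; apply: eq_exist => /=; have pv := hcoord_hrep (p : wpoint K _).
  apply: hcoord_inj (hcoord_param (param_inv_T Tp) (hcoord_param_inv Tp pv)) _.
  have [_ v4] := (T_t18_eq0P pv).1 Tp.
  apply: (hcoord_eq pv); move: (hrep _) v4 => v v4.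
  by apply: eq_from_tnth => -[[|[|[|[|[|//]]]]] i]; rewrite !(tnth_nth 0) /= ?v4 //;
    field; rewrite ?oppr_eq0.
Qed.

Theorem proposition2p3 (R : realType) :
  exists phi : subspace (@T0 R[i]) -> subspace (@T_t18_eq0 R[i]),
    isomorphism phi /\
    forall (p : subspace (@T0 R[i])) (alpha beta gamma delta : R[i])
        (t4 t6 t10 t12 t18 : R[i]),
      hcoord (sval p) [tuple alpha; beta; gamma; delta] ->
      hcoord (sval (phi p)) [tuple t4; t6; t10; t12; t18] ->
      elliptic_isomorphic (S_CD alpha beta gamma delta)
                          (S_t t4 t6 t10 t12 t18).
Proof.
have two : (2 : R[i]) != 0 by rewrite Num.Theory.pnatr_eq0.
have three : (3 : R[i]) != 0 by rewrite Num.Theory.pnatr_eq0.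
exists (@param_iso R[i]); split; first exact: param_isomorphism.
move=> p a b c d t4 t6 t10 t12 t18 pv qt.
(* The given coordinates of phi p are those of the map scaled by l, so mu = 1 / l. *)
have [l /eqP l0 E] := hcoord_orbit (hcoord_param (svalP p) pv) qt.
have e k : [:: t4; t6; t10; t12; t18]`_k =
    (wscale [tuple 4; 6; 10; 12; 18]%N l (param_coord [tuple a; b; c; d]))`_k.
  by rewrite -E.
have := e 4; rewrite wscale_nth //= mulr0 => ->.
apply: (CD_St_isomorphic (mu := l^-1)) => //; first by rewrite invr_neq0.
have := (e 0%N, e 1%N, e 2, e 3); rewrite !wscale_nth //= => -[[[-> ->] ->] ->].
by split; field.
Qed.
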